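(* For every $n\ge 1$ there is a constant $c_n>0$ depending only on $n$ such that the following holds. Let $f$ be a nonconstant locally integrable function on $\mathbb{R}^n$ such that $Mf$ is not identically infinite, and let $w\in A_\infty$ be a weight on $\mathbb{R}^n$. Then, for any cube $Q\subset\mathbb{R}^n$ and any $1\le p<\infty$, $$\left( \frac{1}{w(Q)}\int_Q \left( \frac{Mf(x) - \operatorname{ess\,inf}_{Q} Mf }{M^\# f(x)} \right)^p w(x)\, dx\right)^{1/p} \le c_n\, [w]_{A_\infty}\, p.$$ In particular, if moreover $f\in \mathrm{BMO}$, then for each $1\le p<\infty$, $$\left( \frac{1}{w(Q)}\int_Q \left( Mf(x) - \operatorname{ess\,inf}_{Q} Mf \right)^p w(x)\, dx\right)^{1/p} \le c_n\, [w]_{A_\infty}\, p\, \|f\|_{\mathrm{BMO}}$$ for all cubes $Q$.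
   Context: Cubes are cubes in $\mathbb{R}^n$ with sides parallel to the coordinate axes; $|E|$ is Lebesgue measure and $f_Q=\frac{1}{|Q|}\int_Q f$. ''Nonconstant'' means not almost everywhere equal to a constant. The (uncentered) Hardy–Littlewood maximal function is $Mf(x)=\sup_{Q\ni x}\frac{1}{|Q|}\int_Q |f(y)|\,dy$ and the sharp maximal function is $M^\# f(x)=\sup_{Q\ni x}\frac{1}{|Q|}\int_Q |f(y)-f_Q|\,dy$, the suprema being over all cubes $Q$ containing $x$. $\|f\|_{\mathrm{BMO}}=\sup_Q\frac{1}{|Q|}\int_Q|f-f_Q|$ over all cubes, and $\mathrm{BMO}$ is the set of locally integrable $f$ with $\|f\|_{\mathrm{BMO}}<\infty$. A weight is a locally integrable function $w$ with $w>0$ a.e.; $w(E)=\int_E w$. The Fujii–Wilson constant is $[w]_{A_\infty}=\sup_Q\frac{1}{w(Q)}\int_Q M(w\chi_Q)(x)\,dx$, the supremum over all cubes, and $w\in A_\infty$ means $[w]_{A_\infty}<\infty$. The essential infimum is with respect to Lebesgue measure. *)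

(* Defs.v *)
From HB Require Import structures.
From mathcomp Require Import all_boot all_order all_algebra.
From mathcomp Require Import all_classical all_reals all_analysis.
From mathcomp Require Import ess_sup_inf.
Set Implicit Arguments.
Unset Strict Implicit.
Unset Printing Implicit Defensive.
Import Order.TTheory GRing.Theory Num.Theory.
Import numFieldNormedType.Exports.
Local Open Scope classical_set_scope.
Local Open Scope ring_scope.
Local Open Scope ereal_scope.

(* R^n for n >= 1 is 'rV[R]_n.+1, with the index n shifted by one. *)

Section lebesgue_measure_rV.
Context {R : realType} {n : nat}.
Implicit Types (a b : 'rV[R]_n.+1) (A : set 'rV[R]_n.+1).

Definition box a b : set 'rV[R]_n.+1 :=
  [set x | forall i, (a ord0 i <= x ord0 i <= b ord0 i)%R].

(* The truncation makes the volume zero when b i < a i for some i, that is,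
   when box a b is empty. *)
Definition box_volume a b : R := (\prod_i Num.max 0 (b ord0 i - a ord0 i))%R.

Definition box_cover A := [set I : nat -> 'rV[R]_n.+1 * 'rV[R]_n.+1 |
  A `<=` \bigcup_k box (I k).1 (I k).2].

Definition lebesgue_outer A : \bar R :=
  ereal_inf [set \sum_(k <oo) (box_volume (I k).1 (I k).2)%:E
            | I in box_cover A].

Lemma box_volume_ge0 a b : (0 <= box_volume a b)%R.
Proof. by apply: prodr_ge0 => i _; rewrite le_max lexx. Qed.

Lemma lebesgue_outer_ge0 A : 0 <= lebesgue_outer A.
Proof.
apply: le_ereal_inf_tmp => x [I _ <-].
by apply: nneseries_ge0 => k _ _; rewrite lee_fin box_volume_ge0.
Qed.

Lemma lebesgue_outer0 : lebesgue_outer set0 = 0.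
Proof.
apply/eqP; rewrite eq_le lebesgue_outer_ge0 andbT.
apply: ereal_inf_lbound; exists (fun=> (0%R, 0%R)); first exact: sub0set.
rewrite eseries0// => k _ _ /=.
by rewrite /box_volume big_ord_recl !mxE subrr maxxx mul0r.
Qed.

Lemma le_lebesgue_outer : {homo lebesgue_outer : A B / A `<=` B >-> A <= B}.
Proof.
move=> A B AB; apply/ereal_inf_le_tmp => x [I BI <-].
by exists I => //; exact: subset_trans BI.
Qed.

Lemma lebesgue_outer_sigma_subadditive : sigma_subadditive lebesgue_outer.
Proof.
move=> A; have [[i ioo]|] := pselect (exists i, lebesgue_outer (A i) = +oo).
  rewrite (eseries_pinfty _ _ ioo) ?leey// => k _.
  by rewrite -ltNye (lt_le_trans _ (lebesgue_outer_ge0 _)).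
rewrite -forallNE => Aoo.
suff add2e (e : {posnum R}) : lebesgue_outer (\bigcup_k A k) <=
    \sum_(i <oo) lebesgue_outer (A i) + e%:num%:E.
  by apply/lee_addgt0Pr => _/posnumP[].
rewrite (le_trans _ (epsilon_trick _ _ _))//; last first.
  by move=> k; exact: lebesgue_outer_ge0.
pose vol (I : 'rV[R]_n.+1 * 'rV[R]_n.+1) : \bar R := (box_volume I.1 I.2)%:E.
have vol_ge0 I : 0 <= vol I by rewrite lee_fin box_volume_ge0.
pose P k (I : nat -> 'rV[R]_n.+1 * 'rV[R]_n.+1) := box_cover (A k) I /\
  \sum_(j <oo) vol (I j) <= lebesgue_outer (A k) + (e%:num / (2 ^ k.+1)%:R)%:E.
have [G PG] :
    {G : nat -> nat -> 'rV[R]_n.+1 * 'rV[R]_n.+1 & forall k, P k (G k)}.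
  apply: (@choice _ _ P) => k; rewrite /P /lebesgue_outer.
  set S := (X in ereal_inf X); move infS : (ereal_inf S) => iS.
  case: iS infS => [r Sr|Soo|Soo].
  - have en1 : (0 < e%:num / (2 ^ k.+1)%:R)%R by [].
    have /(lb_ereal_inf_adherent en1) : ereal_inf S \is a fin_num by rewrite Sr.
    move=> [x [I AI muIx] xS].
    by exists I; split => //; rewrite /vol muIx -Sr; exact/ltW.
  - by have := Aoo k; rewrite /lebesgue_outer Soo.
  - suff : lbound S 0 by move/le_ereal_inf_tmp; rewrite Soo.
    by move=> /= _ [I AI <-]; apply: nneseries_ge0 => j _ _; exact: vol_ge0.
have volG_ge0 x : 0 <= (vol \o uncurry G) x by exact: vol_ge0.
apply: (@le_trans _ _ (\esum_(i in setT) (vol \o uncurry G) i)).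
  rewrite /lebesgue_outer; apply: ereal_inf_lbound => /=.
  have /card_esym/ppcard_eqP[h] := card_nat2.
  exists (uncurry G \o h).
    move=> t [i _ /(PG i).1[j _ Bijt]]; exists (h^-1%FUN (i, j)) => //=.
    by rewrite invK ?inE.
  rewrite -(esum_pred_image (vol \o uncurry G) _ xpredT) ?[fun=> _]set_true//.
  by rewrite image_eq.
rewrite (_ : esum _ _ = \sum_(i <oo) \sum_(j <oo) vol (G i j)); last first.
  pose J : nat -> set (nat * nat) := fun i => [set (i, j) | j in setT].
  rewrite (_ : setT = \bigcup_k J k); last first.
    by rewrite predeqE => -[a b]; split => // _; exists a => //; exists b.
  rewrite esum_bigcupT /=; last 2 first.
    - apply/trivIsetP => i j _ _ ij.
      rewrite predeqE => -[k m] /=; split => //= -[] [_] _ [<-{k} _].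
      by move=> [m' _] [] /esym/eqP; rewrite (negbTE ij).
    - by move=> /= [k m]; exact: vol_ge0.
  rewrite -(image_id [set: nat]) -fun_true esum_pred_image//; last first.
    by move=> k _; exact: esum_ge0.
  apply: eq_eseriesr => /= j _.
  rewrite -(esum_pred_image (vol \o uncurry G) (pair j) predT)//=; last first.
    by move=> ? ? _ _; exact: (@can_inj _ _ _ snd).
  by congr esum; rewrite predeqE => -[a b]; split; move=> [i _ <-]; exists i.
apply: lee_lim.
- apply: is_cvg_nneseries => k *.
  by apply: nneseries_ge0 => m *; exact: vol_ge0.
- apply: is_cvg_nneseries => k *.
  by apply: adde_ge0 => //; exact: lebesgue_outer_ge0.
- by near=> k; apply: lee_sum => i _; exact: (PG i).2.
Unshelve. all: by end_near. Qed.

HB.instance Definition _ := isOuterMeasure.Build R 'rV[R]_n.+1 lebesgue_outer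
  lebesgue_outer0 lebesgue_outer_ge0 le_lebesgue_outer
  lebesgue_outer_sigma_subadditive.

Definition lebesgue_outer_measure : {outer_measure set 'rV[R]_n.+1 -> \bar R} :=
  lebesgue_outer.

End lebesgue_measure_rV.

(* 'rV[R]_n.+1 equipped with the sigma-algebra of Lebesgue measurable sets *)
Notation lebesgue_rV_type R n := (caratheodory_type (@lebesgue_outer_measure R n)).

Definition lebesgue_rV (R : realType) (n : nat) :
    {measure set (lebesgue_rV_type R n) -> \bar R} :=
  (@lebesgue_outer_measure R n : set (lebesgue_rV_type R n) -> \bar R).

Section maximal_functions.
Context {R : realType} {n : nat}.
Local Notation mu := (lebesgue_rV R n).
Implicit Types (f w : 'rV[R]_n.+1 -> R) (Q : set 'rV[R]_n.+1).

(* Cubes are closed and have a positive side length. *)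
Definition cube : set (set 'rV[R]_n.+1) :=
  [set Q | exists (a : 'rV[R]_n.+1) (l : R),
    (0 < l)%R /\ Q = box a (a + const_mx l)%R].

Definition loc_integrable f :=
  measurable_fun [set: lebesgue_rV_type R n] f /\
  forall K : set 'rV[R]_n.+1, compact K -> \int[mu]_(x in K) `|f x|%:E < +oo.

Definition ae_constant f := exists c : R, {ae mu, forall x, f x = c}.

Definition mean f Q : R := ((fine (mu Q))^-1 * \int[mu]_(x in Q) f x)%R.

Definition maximal f x : \bar R :=
  ereal_sup [set (mu Q)^-1 * \int[mu]_(y in Q) `|f y|%:E
            | Q in [set Q | cube Q /\ Q x]].

Definition oscillation f Q : \bar R :=
  (mu Q)^-1 * \int[mu]_(y in Q) `|f y - mean f Q|%:E.

Definition sharp_maximal f x : \bar R :=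
  ereal_sup [set oscillation f Q | Q in [set Q | cube Q /\ Q x]].

Definition bmo_norm f : \bar R := ereal_sup [set oscillation f Q | Q in cube].

Definition bmo f := loc_integrable f /\ bmo_norm f < +oo.

Definition weight w := loc_integrable w /\ {ae mu, forall x, (0 < w x)%R}.

Definition weighted_measure w (A : set 'rV[R]_n.+1) : \bar R :=
  \int[mu]_(x in A) (w x)%:E.

(* w \_ Q is the product of w and the indicator function of Q. *)
Definition fujii_wilson w : \bar R :=
  ereal_sup [set (weighted_measure w Q)^-1 * \int[mu]_(x in Q) maximal (w \_ Q) x
            | Q in cube].

Definition Ainfty w := weight w /\ fujii_wilson w < +oo.

(* Essential infimum over Q: the value +oo outside Q does not affect it. *)
Definition ess_inf_on Q (g : 'rV[R]_n.+1 -> \bar R) : \bar R :=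
  ess_inf mu (patch (fun=> +oo) Q g).

(* The L^p(w) norm of g on Q, normalized by w(Q) *)
Definition weighted_Lp_mean w p Q (g : 'rV[R]_n.+1 -> \bar R) : \bar R :=
  ((weighted_measure w Q)^-1 * \int[mu]_(x in Q) (g x `^ p * (w x)%:E)) `^ p^-1.

End maximal_functions.

(* Main.v *)
Require Import Defs.
From mathcomp Require Import all_boot all_order all_algebra.
From mathcomp Require Import all_classical all_reals all_analysis.
From mathcomp Require Import measurable_realfun ess_sup_inf ring lra.
Set Implicit Arguments.
Unset Strict Implicit.
Unset Printing Implicit Defensive.
Import Order.TTheory GRing.Theory Num.Theory.
Import numFieldNormedType.Exports.
Local Open Scope classical_set_scope.
Local Open Scope ring_scope.
Local Open Scope ereal_scope.

(** Write osc f P for the mean of |f - f_P| on a cube P. Fix Q and walk down the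
    tree of its dyadic subcubes. A cube P is a stopping cube if the mean of
    |f - f_S| on P exceeds 2 osc f S, where S is the last stopping cube above P
    (at first Q). Along a path of cubes that contain x, the mean of f changes by
    at most a dimensional multiple of osc f S <= M# f(x) until the next stopping
    cube is met, so it stays within a multiple of N(x) M# f(x) of f_Q, where N(x)
    is the number of stopping cubes that contain x, Q included. An arbitrary cube
    that contains x lies, together with a dyadic cube of comparable size or
    together with Q, in a common cube of comparable size, so that its average
    differs from the one over the latter by another multiple of M# f(x). As the
    average of |f| over a cube that contains Q is at most the essential infimum
    of Mf on Q, this gives the pointwise bound (average_le_leaf_max)
    << Mf(x) - ess inf_Q Mf <= C N(x) M# f(x). >>

    It remains to bound the moments of N. By Chebyshev's inequality the stopping
    cubes inside a stopping cube S cover at most half of S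
    (first_stop_sum_le_half). If E_S is the rest of S, then the weights of the
    stopping cubes S inside a stopping cube P satisfy
    << sum w(S) <= 2 sum (w(S) / |S|) |E_S| <= 2 int_P M(w 1_P) <= 2 [w] w(P) >>
    because the sets E_S are disjoint (fujii_wilson_carleson). This Carleson
    condition at all stopping cubes P is iterated: if N_S counts the stopping
    cubes inside S that contain x, then N^(q+1) <= (q+1) sum N_S^q, so that
    induction on q gives int_Q N^q w <= q! (2 [w])^q w(Q) (leaf_sum_moment_le),
    whence the bound 2 [w] q for the norm of N. Real exponents p are reduced to
    integers q <= 2 p by t^p <= 1 + t^q.

    Everything is done in the tree cut at a finite depth m, where sums over the
    leaves and over the stopping cubes are recursively defined real numbers; the
    depth tends to infinity by monotone convergence (weighted_Lp_mean_le). The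
    maximal functions enter only through inequalities with functions that are
    constant on the leaves, or with limits of these. *)

(** * Integrals of functions that may fail to be measurable *)

(** The integral of a nonnegative function is the supremum of the integrals of
    the simple functions below it, so that it is monotone also on functions
    that are not known to be measurable, such as maximal functions. *)
Lemma le_integral_nonneg_bound d (T : measurableType d) (R : realType)
    (mu : {measure set T -> \bar R}) (D : set T) (f g : T -> \bar R) :
  (forall x, D x -> 0 <= g x) -> (forall x, D x -> f x <= g x) ->
  \int[mu]_(x in D) f x <= \int[mu]_(x in D) g x.
Proof.
move=> g0 fg; rewrite integralE.
apply: (@le_trans _ _ (\int[mu]_(x in D) f^\+ x)).
  by rewrite -[leRHS]sube0 leeB// integral_ge0.
rewrite !ge0_integralE//.
apply: ereal_sup_le => _ [h hf <-]; exists h => // x.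
apply: le_trans (hf x) _; rewrite !patchE.
by case: ifPn => // /set_mem Dx; rewrite funeposE ge_max fg// g0.
Qed.

Lemma integral_pinfty_null d (T : measurableType d) (R : realType)
    (mu : {measure set T -> \bar R}) (D Z : set T) :
  measurable D -> measurable Z -> mu Z = 0 ->
  \int[mu]_(x in D) (+oo * (\1_Z x)%:E) = 0.
Proof.
move=> mD mZ Z0; rewrite ge0_integralZl; [|exact: mD| |by []|by []]; last first.
  by apply/measurable_EFinP; exact: measurable_indic.
rewrite integral_indic// (_ : mu _ = 0) ?mule0//.
by apply: subset_measure0 Z0 => //; exact: measurableI.
Qed.

(** * Lebesgue measure of boxes *)

Section boxes.
Context {R : realType} {n : nat}.
Implicit Types (a b x : 'rV[R]_n.+1).
Local Notation mu := (lebesgue_rV R n).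

Definition set_coord x i (t : R) : 'rV[R]_n.+1 :=
  \row_j (if j == i then t else x ord0 j).

(** A hyperplane that misses the box is covered too: the truncation in the volume
    makes one of the two terms vanish. *)
Lemma box_volume_split a b i c :
  (box_volume a b =
   box_volume a (set_coord b i (Num.min (b ord0 i) c)) +
   box_volume (set_coord a i (Num.max (a ord0 i) c)) b)%R.
Proof.
rewrite /box_volume.
pose len (u v : 'rV[R]_n.+1) j : R := (Num.max 0 (v ord0 j - u ord0 j))%R.
have D1 u v : (\prod_j len u v j = len u v i * \prod_(j | j != i) len u v j)%R.
  by rewrite (bigD1 i).
rewrite (D1 a b) (D1 a (set_coord b i _)) (D1 (set_coord a i _) b).
have -> : (\prod_(j | j != i) len a (set_coord b i (Num.min (b ord0 i) c)) j =
    \prod_(j | j != i) len a b j)%R.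
  by apply: eq_bigr => j /negPf ji; rewrite /len !mxE ji.
have -> : (\prod_(j | j != i) len (set_coord a i (Num.max (a ord0 i) c)) b j =
    \prod_(j | j != i) len a b j)%R.
  by apply: eq_bigr => j /negPf ji; rewrite /len !mxE ji.
rewrite /len !mxE eqxx.
rewrite -mulrDl; congr (_ * _)%R.
move: (a ord0 i) (b ord0 i) => u v; rewrite /Num.max /Num.min.
by case: (ltP v c) => ?; case: (ltP u c) => ?; do ![case: ltP => ?]; lra.
Qed.

(** Cutting the boxes of a cover along the hyperplane yields covers of both sides
    with the same total volume. The hyperplane itself may be shared out in any
    way, which gives open and closed half-spaces at once. *)
Lemma caratheodory_halfspace i (c : R) (H : set 'rV[R]_n.+1) :
  [set x : 'rV[R]_n.+1 | (x ord0 i < c)%R] `<=` H ->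
  H `<=` [set x : 'rV[R]_n.+1 | (x ord0 i <= c)%R] ->
  (@lebesgue_outer_measure R n).-caratheodory H.
Proof.
move=> ltH Hle; apply: le_caratheodory_measurable => X.
apply: le_ereal_inf_tmp => _ [I XI <-].
rewrite (eq_eseriesr (fun k _ => congr1 EFin (box_volume_split (I k).1 (I k).2 i c))).
under eq_eseriesr do rewrite EFinD.
rewrite nneseriesD; [|by move=> *; rewrite lee_fin box_volume_ge0..].
apply: leeD; apply: ereal_inf_lbound.
- exists (fun k => ((I k).1, set_coord (I k).2 i (Num.min ((I k).2 ord0 i) c))) => //.
  move=> x [/XI[k _ Ix] /Hle/= xc]; exists k => // j /=; rewrite mxE.
  by case: eqP => [->|_]; rewrite ?le_min ?xc ?andbT; exact: Ix.
- exists (fun k => (set_coord (I k).1 i (Num.max ((I k).1 ord0 i) c), (I k).2)) => //.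
  move=> x [/XI[k _ Ix] nHx]; exists k => // j /=; rewrite mxE.
  case: eqP => [->|_]; last exact: Ix.
  have xc : (c <= x ord0 i)%R by rewrite leNgt; apply/negP => /ltH.
  by rewrite ge_max xc andbT; exact: Ix.
Qed.

Lemma measurable_coord_le i (c : R) :
  measurable ([set x : 'rV[R]_n.+1 | (x ord0 i <= c)%R] : set (lebesgue_rV_type R n)).
Proof. by apply: (@caratheodory_halfspace i c) => // x /ltW. Qed.

Lemma measurable_coord_ge i (c : R) :
  measurable ([set x : 'rV[R]_n.+1 | (c <= x ord0 i)%R] : set (lebesgue_rV_type R n)).
Proof.
rewrite (_ : mkset _ = ~` [set x : 'rV[R]_n.+1 | (x ord0 i < c)%R]); last first.
  by apply/seteqP; split => x /=; rewrite leNgt => /negP.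
by apply: measurableC; apply: (@caratheodory_halfspace i c) => // x /ltW.
Qed.

Lemma measurable_box a b : measurable (box a b : set (lebesgue_rV_type R n)).
Proof.
rewrite (_ : box a b = \bigcap_(i in [set: 'I_n.+1])
    ([set x : 'rV[R]_n.+1 | (a ord0 i <= x ord0 i)%R] `&`
     [set x : 'rV[R]_n.+1 | (x ord0 i <= b ord0 i)%R])).
  apply: fin_bigcap_measurable => // i _; apply: measurableI.
    exact: measurable_coord_ge.
  exact: measurable_coord_le.
apply/seteqP; split => [x xab i _|x xab i]; first by apply/andP; exact: xab.
by apply/andP; exact: xab.
Qed.

Lemma lebesgue_rV_box_le a b : mu (box a b) <= (box_volume a b)%:E.
Proof.
pose I k : 'rV[R]_n.+1 * 'rV[R]_n.+1 := if k is 0%N then (a, b) else (0, 0)%R.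
apply: ereal_inf_lbound; exists I; first by move=> x xab; exists 0%N.
rewrite (nneseriesD1 (n := 0%N))//; last by move=> k _; rewrite lee_fin box_volume_ge0.
rewrite eseries0 ?adde0// => -[|k] //= _ _.
by rewrite /box_volume big_ord_recl !mxE subrr maxxx mul0r.
Qed.

(** The indicator functions of the boxes of a cover, which are products over the
    coordinates, sum up to at least 1 on the covered box. Integrating this
    inequality in one coordinate after the other turns each indicator function
    into the length of a side. *)
Lemma box_volume_le_cover a b (I : nat -> 'rV[R]_n.+1 * 'rV[R]_n.+1) :
  (forall i, (a ord0 i <= b ord0 i)%R) -> box_cover (box a b) I ->
  (box_volume a b)%:E <= \sum_(k <oo) (box_volume (I k).1 (I k).2)%:E.
Proof.
move=> ab covI.
pose len (u v : 'rV[R]_n.+1) i : R := (Num.max 0 (v ord0 i - u ord0 i))%R.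
have len_ge0 u v i : (0 <= len u v i)%R by rewrite le_max lexx.
pose ind k i (t : R) : R := \1_`[(I k).1 ord0 i, (I k).2 ord0 i] t.
(* The coordinates below d have been integrated out. *)
pose F d k (x : 'rV[R]_n.+1) (i : 'I_n.+1) : R :=
  if (i < d)%N then len (I k).1 (I k).2 i else ind k i (x ord0 i).
have F_ge0 d k x i : (0 <= F d k x i)%R by rewrite /F; case: ifP.
suff key d : (d <= n.+1)%N -> forall x, box a b x ->
    (\prod_(i < n.+1 | (i < d)%N) len a b i)%:E <=
    \sum_(k <oo) (\prod_(i < n.+1) F d k x i)%:E.
  have := key n.+1 (leqnn _) a.
  have -> : (\prod_(i < n.+1 | (i < n.+1)%N) len a b i = \prod_i len a b i)%R.
    by apply: eq_bigl => i; rewrite ltn_ord.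
  move=> h; apply: le_trans (h _) _; first by move=> i; rewrite lexx ab.
  rewrite le_eqVlt; apply/orP; left; apply/eqP; apply: eq_eseriesr => k _.
  by congr EFin; apply: eq_bigr => i _; rewrite /F ltn_ord.
elim: d => [_ x xab|d IH dn x xab].
  rewrite big_pred0//; have [k _ Ikx] := covI x xab.
  rewrite (nneseriesD1 (n := k))//; last by move=> j _; rewrite lee_fin prodr_ge0.
  rewrite (_ : (\prod_(i < n.+1) F 0 k x i)%R = 1%R).
    by rewrite leeDl// nneseries_ge0// => j _ _; rewrite lee_fin prodr_ge0.
  apply: big1 => i _; rewrite /F /= /ind indicE mem_set//= in_itv/=; exact: Ikx.
pose e := Ordinal dn.
have F_set_coord k t : (\prod_(i < n.+1) F d k (set_coord x e t) i =
    ind k e t * \prod_(i < n.+1 | i != e) F d.+1 k x i)%R.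
  rewrite (bigD1 e)//= {1}/F ltnn mxE eqxx; congr (_ * _)%R.
  apply: eq_bigr => i; rewrite -val_eqE /= => ie.
  by rewrite /F mxE -val_eqE /= (negbTE ie) ltnS [in RHS]leq_eqVlt (negbTE ie).
have Fe k : (\prod_(i < n.+1) F d.+1 k x i =
    len (I k).1 (I k).2 e * \prod_(i < n.+1 | i != e) F d.+1 k x i)%R.
  by rewrite (bigD1 e)//= {1}/F /= ltnSn.
have mI k : measurable_fun setT (ind k e) by exact: measurable_indic.
have mF k D : measurable_fun D (fun t => (\prod_(i < n.+1) F d k (set_coord x e t) i)%:E).
  apply/measurable_EFinP; apply: measurable_funTS => //.
  rewrite (_ : (fun t => _) =
      (fun t => ind k e t * \prod_(i < n.+1 | i != e) F d.+1 k x i)%R).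
    exact: measurable_funM.
  by apply/funext => t; exact: F_set_coord.
have -> : (\prod_(i < n.+1 | (i < d.+1)%N) len a b i =
    (b ord0 e - a ord0 e) * \prod_(i < n.+1 | (i < d)%N) len a b i)%R.
  rewrite (bigD1 e)//=; congr (_ * _)%R; first by rewrite /len max_r// subr_ge0.
  by apply: eq_bigl => i; rewrite -val_eqE/= ltnS leq_eqVlt; case: ltngtP.
rewrite EFinM -[X in X * _](_ : lebesgue_measure `[a ord0 e, b ord0 e] = _); last first.
  rewrite lebesgue_measure_itv/= lte_fin lt_neqAle ab andbT.
  by case: eqP => //= ->; rewrite subrr.
rewrite muleC -integral_cst//=.
apply: (@le_trans _ _ (\int[lebesgue_measure]_(t in `[a ord0 e, b ord0 e])
   \sum_(k <oo) (\prod_(i < n.+1) F d k (set_coord x e t) i)%:E)).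
  apply: ge0_le_integral => //=.
  - by move=> t _; rewrite lee_fin prodr_ge0.
  - apply: ge0_emeasurable_sum => [k t _ _|k _]; last exact: mF.
    by rewrite lee_fin prodr_ge0.
  - move=> t; rewrite in_itv/= => tab; apply: IH; first exact: ltnW.
    by move=> i; rewrite mxE; case: eqP => [->|].
rewrite integral_nneseries//=; last 2 first.
- by move=> k; exact: mF.
- by move=> k t _; rewrite lee_fin prodr_ge0.
apply: lee_nneseries => [k _ _|k _].
  by apply: integral_ge0 => t _; rewrite lee_fin prodr_ge0.
under eq_integral do rewrite F_set_coord mulrC EFinM.
rewrite ge0_integralZl//=; last 3 first.
- by apply: measurable_funTS; apply/measurable_EFinP; exact: mI.
- by move=> t _; rewrite lee_fin.
- by rewrite lee_fin prodr_ge0.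
rewrite Fe EFinM muleC lee_pmul//; [|by rewrite lee_fin prodr_ge0|].
  by apply: integral_ge0 => t _; rewrite lee_fin.
rewrite integral_indic//= /len.
apply: (@le_trans _ _ (lebesgue_measure `[(I k).1 ord0 e, (I k).2 ord0 e])).
  by apply: le_measure; rewrite ?inE//=; apply: measurableI.
by rewrite lebesgue_measure_itv/= lte_fin; case: ifPn => [_|_];
  rewrite lee_fin le_max lexx ?orbT.
Qed.

Lemma lebesgue_rV_box a b : (forall i, (a ord0 i <= b ord0 i)%R) ->
  mu (box a b) = (box_volume a b)%:E.
Proof.
move=> ab; apply/eqP; rewrite eq_le lebesgue_rV_box_le/=.
by apply: le_ereal_inf_tmp => _ [I covI <-]; exact: box_volume_le_cover.
Qed.

Lemma compact_box a b : compact (box a b).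
Proof.
rewrite (_ : box a b = [set v | forall i, `[a ord0 i, b ord0 i]%classic (v ord0 i)]).
  apply: (@rV_compact R _ (fun i => `[a ord0 i, b ord0 i]%classic)) => i.
  exact: segment_compact.
by apply/seteqP; split => x /= xab i; have := xab i; rewrite /= in_itv.
Qed.

End boxes.

(** * Cubes and their dyadic children *)

Section cubes.
Context {R : realType} {n : nat}.
Implicit Types (x y : 'rV[R]_n.+1).
Local Notation mu := (lebesgue_rV R n).

(** Lowest corner and side length. Their positivity is part of the type, so that
    volumes may be divided by without side conditions. *)
Definition cubes : Type := ('rV[R]_n.+1 * {posnum R})%type.
Implicit Types (P Q S : cubes) (e : {ffun 'I_n.+1 -> bool}).

Definition cube_set P : set 'rV[R]_n.+1 := box P.1 (P.1 + const_mx P.2%:num)%R.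

Lemma cube_setE P x : cube_set P x <->
  forall i, (P.1 ord0 i <= x ord0 i <= P.1 ord0 i + P.2%:num)%R.
Proof. by split=> h i; have := h i; rewrite !mxE. Qed.

Lemma cubeP (Q : set 'rV[R]_n.+1) : cube Q <-> exists P, Q = cube_set P.
Proof.
split=> [[a [l [l0 ->]]]|[[a l] ->]]; first by exists (a, PosNum l0).
by exists a, l%:num; split.
Qed.

Lemma measurable_cube P : measurable (cube_set P : set (lebesgue_rV_type R n)).
Proof. exact: measurable_box. Qed.

Definition vol P : R := (P.2%:num ^+ n.+1)%R.

Lemma vol_gt0 P : (0 < vol P)%R. Proof. by rewrite exprn_gt0. Qed.

Lemma lebesgue_rV_cube P : mu (cube_set P) = (vol P)%:E.
Proof.
rewrite lebesgue_rV_box => [|i]; last by rewrite !mxE lerDl.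
rewrite /box_volume (eq_bigr (fun=> P.2%:num)) => [|i _]; last first.
  by rewrite !mxE addrAC subrr add0r max_r.
by rewrite prodr_const card_ord.
Qed.

(** The children are closed cubes, so that every point of P, boundary included,
    lies in one of them; the price is that they have common faces. *)
Definition child P e : cubes :=
  (P.1 + \row_i (if e i then P.2%:num / 2 else 0), (P.2%:num / 2)%:pos)%R.

Lemma childE P e x : cube_set (child P e) x <->
  forall i, (if e i then P.1 ord0 i + P.2%:num / 2 <= x ord0 i <= P.1 ord0 i + P.2%:num
             else P.1 ord0 i <= x ord0 i <= P.1 ord0 i + P.2%:num / 2)%R.
Proof.
rewrite cube_setE; split=> h i; have := h i; rewrite /= !mxE; case: (e i);
  rewrite ?addr0 => /andP[? ?]; apply/andP; split; lra.
Qed.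

Lemma child_subset P e : cube_set (child P e) `<=` cube_set P.
Proof.
move=> x /childE h; apply/cube_setE => i; have := h i.
have : (0 < P.2%:num)%R by [].
by case: (e i) => ? /andP[? ?]; apply/andP; split; lra.
Qed.

Lemma child_cover P x : cube_set P x -> exists e, cube_set (child P e) x.
Proof.
move=> /cube_setE h.
exists [ffun i : 'I_n.+1 => (P.1 ord0 i + P.2%:num / 2 <= x ord0 i)%R].
apply/childE => i; rewrite ffunE; have /andP[? ?] := h i.
by case: leP => ?; apply/andP; split; lra.
Qed.

Lemma vol_child P e : vol P = (2 ^+ n.+1 * vol (child P e))%R.
Proof. by rewrite /vol/= -exprMn mulrCA divff ?mulr1. Qed.

(** The common faces of the children have measure zero, so the children may be
    treated as disjoint. *)
Lemma ge0_integral_children P (F : 'rV[R]_n.+1 -> \bar R) :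
  measurable_fun [set: lebesgue_rV_type R n] F -> (forall x, 0 <= F x) ->
  \int[mu]_(x in cube_set P) F x =
  \sum_e \int[mu]_(x in cube_set (child P e)) F x.
Proof.
move=> mF F0.
pose mid i : R := (P.1 ord0 i + P.2%:num / 2)%R.
pose face i : set (lebesgue_rV_type R n) :=
  box (set_coord P.1 i (mid i)) (set_coord (P.1 + const_mx P.2%:num)%R i (mid i)).
pose N : set (lebesgue_rV_type R n) := \big[setU/set0]_(i < n.+1) face i.
have face0 i : mu (face i) = 0.
  apply/eqP; rewrite -measure_le0; apply: le_trans (lebesgue_rV_box_le _ _) _.
  by rewrite /box_volume (bigD1 i)//= !mxE eqxx subrr maxxx mul0r.
have [mN N0] : measurable N /\ mu N = 0.
  rewrite /N; elim/big_ind: _ => [|A B [mA A0] [mB B0]|i _].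
  - by split; [exact: measurable0|exact: measure0].
  - by split; [exact: measurableU|rewrite measureU0].
  - by split; [exact: measurable_box|].
have faceN x i : cube_set P x -> x ord0 i = mid i -> N x.
  move=> /cube_setE Px xi; rewrite /N.
  rewrite -(bigcup_pred predT face); exists i => // j /=; rewrite !mxE.
  by case: eqP => [->|_]; rewrite ?xi ?lexx//; exact: Px.
have removeN Q : \int[mu]_(x in cube_set Q) F x = \int[mu]_(x in cube_set Q `\` N) F x.
  apply: ge0_negligible_integral => //; first exact: measurable_cube.
  exact: measurable_funTS.
rewrite removeN; under eq_bigr do rewrite removeN.
rewrite (_ : cube_set P `\` N = \big[setU/set0]_(e <- enum {ffun 'I_n.+1 -> bool})
    (cube_set (child P e) `\` N)); last first.
  rewrite big_enum/= -(bigcup_pred predT (fun e => cube_set (child P e) `\` N)).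
  apply/seteqP; split => [x [Px Nx]|x [e _ [Px Nx]]].
    by have [e ?] := child_cover Px; exists e.
  by split => //; exact: child_subset Px.
rewrite ge0_integral_bigsetU//.
- by rewrite big_enum.
- by move=> e; apply: measurableD => //; exact: measurable_cube.
- exact: enum_uniq.
- move=> e e' _ _ [x [[ex Nx] [e'x _]]]; apply/ffunP => i.
  apply: contrapT => /eqP ee'; apply: Nx; apply: (@faceN x i).
    exact: child_subset ex.
  move: ex e'x ee' => /childE/(_ i) + /childE/(_ i).
  rewrite /mid; case: (e i); case: (e' i) => // /andP[? ?] /andP[? ?] _;
    by apply/eqP; rewrite eq_le; apply/andP; split.
- exact: measurable_funTS.
Qed.

(** The lowest corner of the common cube is the coordinatewise minimum of the two
    corners; because of the common point, these differ in each coordinate by at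
    most the larger side. *)
Lemma cube_hull P Q x : cube_set P x -> cube_set Q x ->
  (P.2%:num <= Q.2%:num)%R ->
  exists S, [/\ cube_set P `<=` cube_set S, cube_set Q `<=` cube_set S &
    S.2%:num = (2 * Q.2%:num)%R].
Proof.
move=> /cube_setE Px /cube_setE Qx PQ.
exists (\row_i Num.min (P.1 ord0 i) (Q.1 ord0 i), (2 * Q.2%:num)%:pos)%R.
have P0 : (0 < P.2%:num)%R by [].
split=> // y /cube_setE h; apply/cube_setE => i; move: (Px i) (Qx i) (h i) => /=;
  rewrite mxE => /andP[? ?] /andP[? ?] /andP[? ?]; rewrite ge_min;
  by apply/andP; split; [lra|]; rewrite /Num.min; case: ltP => ?; lra.
Qed.

End cubes.
Arguments cubes : clear implicits.

(** * Stopping cubes in a finitely branching tree *)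

Section stopping_tree.
Local Open Scope ring_scope.
Context {R : realFieldType} {C : Type} {E : finType}.
Variables (child : C -> E -> C) (stop : C -> C -> bool).
Implicit Types (S P : C) (m k q : nat) (v w : C -> R).

(** In this and the next recursions, m generations below P remain to be explored
    and S is the last stopping cube met on the way to P. The sum extends over all
    stopping cubes strictly below P, phi being told the depth left below them. *)
Fixpoint stop_sum (phi : nat -> C -> R) m S P : R :=
  if m is m'.+1 then \sum_e let P' := child P e in
    if stop S P' then phi m' P' + stop_sum phi m' P' P' else stop_sum phi m' S P'
  else 0.

Fixpoint first_stop_sum v m S P : R :=
  if m is m'.+1 then \sum_e let P' := child P e in
    if stop S P' then v P' else first_stop_sum v m' S P'
  else 0.

(** The integral with respect to v of a function that is constant on the leaves:
    its value is g k S where k stopping cubes have been met and S is the last. *)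
Fixpoint leaf_sum (g : nat -> C -> R) v m S k P : R :=
  if m is m'.+1 then \sum_e let P' := child P e in
    if stop S P' then leaf_sum g v m' P' k.+1 P' else leaf_sum g v m' S k P'
  else g k S * v P.

Lemma leaf_sum_cst v m S k P : (forall P, \sum_e v (child P e) = v P) ->
  leaf_sum (fun _ _ => 1) v m S k P = v P.
Proof.
move=> vD; elim: m S k P => [|m IH] S k P /=; first by rewrite mul1r.
by rewrite -[RHS]vD; apply: eq_bigr => e _; rewrite !IH if_same.
Qed.

Lemma leaf_sum_affine_le g h v (a b : R) m S k P :
  (forall P, 0 <= v P) -> (forall P, \sum_e v (child P e) = v P) ->
  (forall k S, g k S <= a + b * h k S) ->
  leaf_sum g v m S k P <= a * v P + b * leaf_sum h v m S k P.
Proof.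
move=> v0 vD gh; elim: m S k P => [|m IH] S k P /=.
  by rewrite mulrA -mulrDl ler_wpM2r.
rewrite -(vD P) !mulr_sumr -big_split/=; apply: ler_sum => e _.
by case: ifP => _; exact: IH.
Qed.

Lemma stop_sum_le phi a v m S P : 0 <= a ->
  (forall m P, phi m P <= a * v P) ->
  stop_sum phi m S P <= a * stop_sum (fun=> v) m S P.
Proof.
move=> a0 le_phi; elim: m S P => [|m IH] S P /=; first by rewrite mulr0.
rewrite mulr_sumr; apply: ler_sum => e _; case: ifP => _; last exact: IH.
by rewrite mulrDr lerD.
Qed.

Section weak_type.
Variables (v : C -> R) (Phi : C -> C -> R).
Hypothesis v_gt0 : forall P, 0 < v P.
Hypothesis Phi_ge0 : forall S P, 0 <= Phi S P.
Hypothesis PhiD : forall S P, \sum_e Phi S (child P e) = Phi S P.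
Hypothesis stopP : forall S P, stop S P = (2 * Phi S S * v P < Phi S P * v S).

(** Chebyshev's inequality. When Phi S S = 0, there is no stopping cube at all,
    because stopP is strict. *)
Lemma first_stop_sum_le_half m S : first_stop_sum v m S S <= v S / 2.
Proof.
have [S0|S_gt0] := eqVneq (Phi S S) 0.
  suff -> : first_stop_sum v m S S = 0 by rewrite divr_ge0// ltW.
  suff zero P : Phi S P = 0 -> first_stop_sum v m S P = 0 by exact: zero.
  elim: m P => // m IH P P0 /=; apply: big1 => e _.
  have Pe0 : Phi S (child P e) = 0.
    apply: (@psumr_eq0P _ _ predT (fun e => Phi S (child P e))) => //.
    by rewrite PhiD.
  by rewrite stopP S0 Pe0 mulr0 !mul0r ltxx; exact: IH.
have weak P : 2 * Phi S S * first_stop_sum v m S P <= Phi S P * v S.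
  elim: m P => [|m IH] P /=; first by rewrite mulr0 mulr_ge0// ltW.
  rewrite -(PhiD S P) mulr_sumr mulr_suml; apply: ler_sum => e _.
  by case: ifP => [|_]; [rewrite stopP => /ltW|exact: IH].
have := weak S; have : 0 < Phi S S by rewrite lt_neqAle eq_sym S_gt0 Phi_ge0.
by move=> h; rewrite -mulrA mulrCA ler_pM2l// ler_pdivlMr// mulrC.
Qed.
End weak_type.

Section carleson.
Variables (v w : C -> R).
Hypothesis v_gt0 : forall P, 0 < v P.
Hypothesis w_ge0 : forall P, 0 <= w P.
Hypothesis vD : forall P, \sum_e v (child P e) = v P.
Hypothesis sparse : forall m S, first_stop_sum v m S S <= v S / 2.

(** At least half of each stopping cube is free of smaller ones, and there the
    leaf function is the average of w over that cube. *)
Lemma stop_sum_le_leaf_sum m S k :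
  w S + stop_sum (fun=> w) m S S <=
  2 * leaf_sum (fun _ S => w S / v S) v m S k S.
Proof.
have half m' S' : w S' / 2 <= w S' / v S' * (v S' - first_stop_sum v m' S' S').
  rewrite -mulrA ler_wpM2l// ler_pdivlMl//; have := sparse m' S'; lra.
suff bound P : w S / v S * (v P - first_stop_sum v m S P)
    + stop_sum (fun=> w) m S P / 2 <=
    leaf_sum (fun _ S => w S / v S) v m S k P.
  by have := bound S; have := half m S; lra.
elim: m S k P => [|m IH] S k P /=; first by rewrite subr0 mul0r addr0.
rewrite -(vD P) -sumrB mulr_sumr mulr_suml -big_split/=; apply: ler_sum => e _.
case: ifP => _; last exact: IH.
rewrite subrr mulr0 add0r; apply: le_trans (IH _ _ _).
by have := half m (child P e); lra.
Qed.
End carleson.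

(** The discrete form of the derivative of t ^ q.+1. *)
Lemma exprS_le q k :
  k.+1%:R ^+ q.+1 <= k%:R ^+ q.+1 + q.+1%:R * k.+1%:R ^+ q :> R.
Proof.
have nat1 j : j.+1%:R = j%:R + 1 :> R by rewrite -addn1 natrD.
elim: q => [|q IH]; first by rewrite !expr1 expr0 mulr1 nat1.
rewrite (nat1 q.+1) mulrDl mul1r addrA (exprS _ q.+1) {1}(nat1 k) mulrDl mul1r.
rewrite lerD2r; apply: le_trans (ler_wpM2l (ler0n R k) IH) _.
rewrite mulrDr -exprS lerD2l mulrCA ler_wpM2l//.
by rewrite [leRHS]exprS ler_wpM2r ?exprn_ge0// ler_nat.
Qed.

Section moments.
Variables (w : C -> R) (A : R).
Hypothesis w_ge0 : forall P, 0 <= w P.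
Hypothesis wD : forall P, \sum_e w (child P e) = w P.
Hypothesis A_ge0 : 0 <= A.
Hypothesis carleson : forall m S, w S + stop_sum (fun=> w) m S S <= A * w S.

Let moment q m S k P := leaf_sum (fun k _ => k%:R ^+ q) w m S k P.

Let momentS q m S k P :
  moment q.+1 m S k.+1 P <= moment q.+1 m S k P + q.+1%:R * moment q m S k.+1 P.
Proof.
rewrite /moment; elim: m S k P => [|m IH] S k P /=.
  by rewrite mulrA -mulrDl ler_wpM2r// exprS_le.
by rewrite mulr_sumr -big_split/=; apply: ler_sum => e _; case: ifP.
Qed.

(** A path with N stops satisfies N ^ q.+1 <= q.+1 * (1 ^ q + ... + N ^ q), and
    j is the number of stops counted from the j-th stop from below, included. *)
Let moment_stop_sum q m S P :
  moment q.+1 m S 0 P <= q.+1%:R * stop_sum (fun m P => moment q m P 1 P) m S P.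
Proof.
rewrite /moment; elim: m S P => [|m IH] S P /=.
  by rewrite expr0n/= mul0r mulr0.
rewrite mulr_sumr; apply: ler_sum => e _; case: ifP => _; last exact: IH.
rewrite mulrDr; have := IH (child P e) (child P e).
by have := momentS q m (child P e) 0 (child P e); rewrite /moment; lra.
Qed.

(** Each application of the Carleson condition lowers the exponent by one. The
    resulting moments are those of an exponential distribution with mean A. *)
Lemma leaf_sum_moment_le q m S :
  leaf_sum (fun k _ => k%:R ^+ q) w m S 1 S <= q`!%:R * A ^+ q * w S.
Proof.
elim: q m S => [|q IH] m S.
  by rewrite (_ : (fun k _ => _) = fun _ _ => 1)// leaf_sum_cst// !expr0 !mul1r.
apply: le_trans (momentS q m S 0 S) _.
have a0 : 0 <= q`!%:R * A ^+ q by rewrite mulr_ge0// exprn_ge0.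
apply: (@le_trans _ _ (q.+1%:R * (q`!%:R * A ^+ q * (A * w S)))); last first.
  by rewrite factS natrM exprS [A * A ^+ q]mulrC !mulrA.
apply: le_trans (lerD (moment_stop_sum q m S S) (lexx _)) _.
rewrite -mulrDr ler_wpM2l//; apply: le_trans (ler_wpM2l a0 (carleson m S)).
by rewrite mulrDr addrC lerD//; [exact: IH|exact: stop_sum_le].
Qed.
End moments.

End stopping_tree.

(** * Integrals, means and oscillations on cubes *)

Section local_integrals.
Context {R : realType} {n : nat}.
Implicit Types (f h : 'rV[R]_n.+1 -> R) (P Q S : cubes R n) (c : R).
Local Notation mu := (lebesgue_rV R n).

Definition abs_int h P : R := fine (\int[mu]_(x in cube_set P) `|h x|%:E).

Lemma measurable_abs h (D : set (lebesgue_rV_type R n)) :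
  measurable_fun [set: lebesgue_rV_type R n] h ->
  measurable_fun D (fun x => `|h x|%:E).
Proof.
move=> mh; apply: measurable_funTS; apply/measurable_EFinP.
exact: measurableT_comp.
Qed.

(** Restricting to cubes, whose measure is known to be finite, makes stability
    under subtraction of a constant immediate. *)
Definition cube_integrable h :=
  measurable_fun [set: lebesgue_rV_type R n] h /\
  forall P, \int[mu]_(x in cube_set P) `|h x|%:E < +oo.

Lemma loc_integrable_cube h : loc_integrable h -> cube_integrable h.
Proof. by move=> [mh hfin]; split=> // P; apply: hfin; exact: compact_box. Qed.

Lemma abs_intE h P : cube_integrable h ->
  \int[mu]_(x in cube_set P) `|h x|%:E = (abs_int h P)%:E.
Proof.
by move=> [_ hfin]; rewrite fineK// ge0_fin_numE ?hfin// integral_ge0.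
Qed.

Lemma abs_int_ge0 h P : (0 <= abs_int h P)%R.
Proof. by rewrite fine_ge0// integral_ge0. Qed.

Lemma cube_integrable_integrable h P : cube_integrable h ->
  mu.-integrable (cube_set P) (EFin \o h).
Proof.
move=> [mh hfin]; apply/integrableP; split; last exact: hfin.
by apply/measurable_EFinP; exact: measurable_funTS.
Qed.

Lemma cube_integrable_cst c : cube_integrable (fun=> c).
Proof.
split=> [|P]; first exact: measurable_cst.
rewrite integral_cst; last exact: measurable_cube.
by rewrite lebesgue_rV_cube -EFinM ltry.
Qed.

Lemma cube_integrable_subc f c : cube_integrable f ->
  cube_integrable (fun x => f x - c)%R.
Proof.
move=> [mf ffin]; split=> [|P].
  by apply: measurable_funB => //; exact: measurable_cst.
have := lte_add_pinfty (ffin P) ((cube_integrable_cst c).2 P).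
have mP := @measurable_cube R n P.
have m1 := measurable_abs (D := cube_set P) mf.
have m2 := measurable_abs (D := cube_set P) (cube_integrable_cst c).1.
rewrite -ge0_integralD//.
apply: le_lt_trans; apply: le_integral_nonneg_bound => x _.
  by rewrite -EFinD lee_fin addr_ge0.
by rewrite -EFinD lee_fin ler_normB.
Qed.

Lemma abs_int_children h P : cube_integrable h ->
  (\sum_e abs_int h (child P e) = abs_int h P)%R.
Proof.
move=> hl; apply: EFin_inj; rewrite -(abs_intE P hl) ge0_integral_children.
- by rewrite -sumEFin; apply: eq_bigr => e _; rewrite (abs_intE _ hl).
- by apply: measurable_abs; exact: hl.1.
- by [].
Qed.

Lemma abs_int_subset h P S : cube_integrable h ->
  cube_set P `<=` cube_set S -> (abs_int h P <= abs_int h S)%R.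
Proof.
move=> hl PS; rewrite -lee_fin -(abs_intE P hl) -(abs_intE S hl).
apply: ge0_subset_integral; [exact: measurable_cube..| |by []|exact: PS].
by apply: measurable_abs; exact: hl.1.
Qed.

(** S and P are separate arguments because f is compared with its mean on a
    stopping cube S on all the cubes P below; mean_dev f P P / vol P is the
    oscillation of f on P. *)
Definition mean_dev f S P : R := abs_int (fun x => f x - mean f (cube_set S))%R P.

Lemma abs_mean_sub_le f c P : cube_integrable f ->
  (`|mean f (cube_set P) - c| <= abs_int (fun x => f x - c)%R P / vol P)%R.
Proof.
move=> fl; have v0 := vol_gt0 P.
have fi := cube_integrable_integrable P fl.
have fci := cube_integrable_integrable P (cube_integrable_subc c fl).
rewrite ler_pdivlMr// -[X in (_ * X)%R](gtr0_norm v0) -normrM.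
have -> : ((mean f (cube_set P) - c) * vol P = \int[mu]_(x in cube_set P) (f x - c))%R.
  have ci := cube_integrable_integrable P (cube_integrable_cst c).
  rewrite RintegralB//; last exact: measurable_cube.
  rewrite Rintegral_cst; last exact: measurable_cube.
  by rewrite /mean lebesgue_rV_cube/= mulrBl mulrAC mulVf ?gt_eqF// mul1r.
by apply: le_normr_Rintegral => //; exact: measurable_cube.
Qed.

Lemma abs_int_le f c P : cube_integrable f ->
  (abs_int f P <= `|c| * vol P + abs_int (fun x => f x - c)%R P)%R.
Proof.
move=> fl; have fcl := cube_integrable_subc c fl.
have mP := @measurable_cube R n P.
have m1 := measurable_abs (D := cube_set P) (cube_integrable_cst c).1.
have m2 := measurable_abs (D := cube_set P) fcl.1.
rewrite -lee_fin EFinD -!abs_intE//.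
apply: (@le_trans _ _ (\int[mu]_(x in cube_set P) (`|c|%:E + `|f x - c|%:E))).
  apply: le_integral_nonneg_bound => x _; rewrite -EFinD lee_fin ?addr_ge0//.
  by rewrite -{1}(subrK c (f x)) addrC ler_normD.
by rewrite ge0_integralD// integral_cst// lebesgue_rV_cube EFinM.
Qed.

Lemma oscillationE f P : cube_integrable f ->
  oscillation f (cube_set P) = (mean_dev f P P / vol P)%:E.
Proof.
move=> fl; rewrite /oscillation (abs_intE P (cube_integrable_subc _ fl)).
by rewrite lebesgue_rV_cube inver gt_eqF ?vol_gt0// -EFinM mulrC.
Qed.

Lemma averageE h P : cube_integrable h ->
  (mu (cube_set P))^-1 * \int[mu]_(y in cube_set P) `|h y|%:E = (abs_int h P / vol P)%:E.
Proof.
move=> hl; rewrite abs_intE// lebesgue_rV_cube inver gt_eqF ?vol_gt0//.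
by rewrite -EFinM mulrC.
Qed.

End local_integrals.

(** * Functions computed along the paths of the tree *)

Section leaf_functions.
Context {R : realType} {n : nat}.
Variable stop : cubes R n -> cubes R n -> bool.
Implicit Types (S P Q : cubes R n) (m k : nat) (x : 'rV[R]_n.+1).
Implicit Types (g : nat -> cubes R n -> R) (h : 'rV[R]_n.+1 -> R).
Local Notation mu := (lebesgue_rV R n).

(** The function constant on the leaves whose integral is leaf_sum. Taking the
    maximum over the children that contain x makes it independent of a choice on
    common faces, and keeps the bounds on the leaves true there. *)
Fixpoint leaf_max g m S k P x : R :=
  if m is m'.+1 then (\big[Num.max/0]_e let P' := child P e in
    \1_(cube_set P') x * if stop S P' then leaf_max g m' P' k.+1 P' x
                         else leaf_max g m' S k P' x)%R
  else g k S.

Lemma leaf_max_ge_child g m S k P x e : cube_set (child P e) x ->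
  ((if stop S (child P e) then leaf_max g m (child P e) k.+1 (child P e) x
   else leaf_max g m S k (child P e) x) <= leaf_max g m.+1 S k P x)%R.
Proof.
by move=> ex /=; apply: le_trans (le_bigmax _ _ e); rewrite /= indicE mem_set// mul1r.
Qed.

Section nonneg.
Variable g : nat -> cubes R n -> R.
Hypothesis g_ge0 : forall k S, (0 <= g k S)%R.

Lemma leaf_max_ge0 m S k P x : (0 <= leaf_max g m S k P x)%R.
Proof. by case: m => [|m] //=; exact: bigmax_ge_id. Qed.

Lemma measurable_leaf_max m S k P :
  measurable_fun [set: lebesgue_rV_type R n] (leaf_max g m S k P).
Proof.
elim: m S k P => [|m IH] S k P; first exact: measurable_cst.
pose F e x : R := (\1_(cube_set (child P e)) x *
    if stop S (child P e) then leaf_max g m (child P e) k.+1 (child P e) x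
    else leaf_max g m S k (child P e) x)%R.
have mF e : measurable_fun [set: lebesgue_rV_type R n] (F e).
  apply: measurable_funM; first by apply: measurable_indic; exact: measurable_cube.
  by case: (stop S (child P e)); exact: IH.
have -> : leaf_max g m.+1 S k P = (fun x =>
    \big[Num.max/0%R]_(e <- enum {ffun 'I_n.+1 -> bool}) F e x).
  by apply/funext => x; rewrite big_enum.
elim: (enum _) => [|e r IHr].
  have -> : (fun x => \big[Num.max/0%R]_(e <- [::]) F e x) = cst 0%R.
    by apply/funext => x; rewrite big_nil.
  exact: measurable_cst.
have -> : (fun x => \big[Num.max/0%R]_(e <- e :: r) F e x) =
    (F e \max (fun x => \big[Num.max/0%R]_(e <- r) F e x))%R.
  by apply/funext => x; rewrite big_cons.
by apply: measurable_maxr; [exact: mF|exact: IHr].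
Qed.

Let density h m S k P x : \bar R := (leaf_max g m S k P x * `|h x|)%R%:E.

Let density_ge0 h m S k P x : 0 <= density h m S k P x.
Proof. by rewrite lee_fin mulr_ge0// leaf_max_ge0. Qed.

Lemma measurable_leaf_density h m S k P (D : set (lebesgue_rV_type R n)) :
  cube_integrable h ->
  measurable_fun D (fun x => (leaf_max g m S k P x * `|h x|)%R%:E).
Proof.
move=> hl; apply: measurable_funTS; apply/measurable_EFinP.
apply: measurable_funM; first exact: measurable_leaf_max.
by apply: measurableT_comp => //; exact: hl.1.
Qed.

Let density_leaf h S k P : cube_integrable h ->
  \int[mu]_(x in cube_set P) density h 0 S k P x = (g k S * abs_int h P)%:E.
Proof.
move=> hl; rewrite EFinM -(abs_intE P hl) -ge0_integralZl.
- by apply: eq_integral => x _; rewrite -EFinM.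
- exact: measurable_cube.
- by apply: measurable_abs; exact: hl.1.
- by move=> x _; rewrite lee_fin.
- by rewrite lee_fin.
Qed.

(** On a child the maximum is at least the function computed below this child, and
    the integral is additive over the children. *)
Lemma leaf_sum_le_integral h m S k P : cube_integrable h ->
  (leaf_sum child stop g (abs_int h) m S k P)%:E <=
  \int[mu]_(x in cube_set P) (leaf_max g m S k P x * `|h x|)%:E.
Proof.
move=> hl; elim: m S k P => [|m IH] S k P; first by rewrite density_leaf.
rewrite (ge0_integral_children P (measurable_leaf_density m.+1 S k P hl)); last first.
  exact: density_ge0.
rewrite /= -sumEFin; apply: lee_sum => e _.
case: ifPn => se; (apply: le_trans (IH _ _ _) _; apply: le_integral_nonneg_bound => x ex;
  first exact: (density_ge0 _ m.+1));
  rewrite lee_fin ler_wpM2r//; have := leaf_max_ge_child g m S k ex;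
  by rewrite ?se ?(negPf se).
Qed.

(** The maximum is at most the sum of the functions computed below the children,
    each extended by zero. *)
Lemma integral_le_leaf_sum h m S k P : cube_integrable h ->
  \int[mu]_(x in cube_set P) (leaf_max g m S k P x * `|h x|)%:E <=
  (leaf_sum child stop g (abs_int h) m S k P)%:E.
Proof.
move=> hl; elim: m S k P => [|m IH] S k P; first by rewrite density_leaf.
pose F e : 'rV[R]_n.+1 -> \bar R := if stop S (child P e)
  then density h m (child P e) k.+1 (child P e) else density h m S k (child P e).
have F0 e x : 0 <= F e x by rewrite /F; case: ifP => _; exact: density_ge0.
have mF e : measurable_fun [set: lebesgue_rV_type R n] (F e).
  by rewrite /F; case: ifP => _; exact: measurable_leaf_density.
have F0' e x : 0 <= (F e \_ (cube_set (child P e))) x.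
  by rewrite patchE; case: ifP.
apply: (@le_trans _ _ (\int[mu]_(x in cube_set P) \sum_e
    (F e \_ (cube_set (child P e))) x)).
  apply: le_integral_nonneg_bound => x Px; first exact: sume_ge0.
  have -> : \sum_e (F e \_ (cube_set (child P e))) x =
      (\sum_e \1_(cube_set (child P e)) x * (if stop S (child P e) then
        leaf_max g m (child P e) k.+1 (child P e) x else
        leaf_max g m S k (child P e) x) * `|h x|)%R%:E.
    rewrite -sumEFin; apply: eq_bigr => e _; rewrite patchE indicE /F.
    by case: ifP => _; rewrite ?mul1r ?mul0r//; case: ifP.
  rewrite lee_fin -mulr_suml ler_wpM2r//=.
  have term_ge0 e : (0 <= \1_(cube_set (child P e)) x * (if stop S (child P e) then
        leaf_max g m (child P e) k.+1 (child P e) x else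
        leaf_max g m S k (child P e) x))%R.
    by rewrite mulr_ge0//; case: ifP => _; exact: leaf_max_ge0.
  apply: bigmax_le => [|e _]; first exact: sumr_ge0.
  by rewrite [leRHS](bigD1 e)//= lerDl sumr_ge0.
rewrite (ge0_integral_sum mu (measurable_cube P)) => [|e|e x _]; last 2 first.
- apply: measurable_funTS; apply/(measurable_restrictT _ _).1 => //.
    exact: measurable_cube.
  exact: measurable_funTS.
- exact: F0'.
rewrite /= -sumEFin; apply: lee_sum => e _.
apply: (@le_trans _ _ (\int[mu]_(x in cube_set P `&` cube_set (child P e)) F e x)).
  by rewrite integral_mkcondr.
rewrite setIidr; last exact: child_subset.
by rewrite /F; case: ifP => _; exact: IH.
Qed.

End nonneg.
End leaf_functions.

(** More stopping cubes are met when one more generation is explored. *)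
Lemma leaf_max_nondecreasing (R : realType) (n : nat)
    (stop : cubes R n -> cubes R n -> bool) (g : nat -> R) m S k P x :
  (forall k, 0 <= g k)%R -> {homo g : i j / (i <= j)%N >-> (i <= j)%R} ->
  cube_set P x ->
  (leaf_max stop (fun k _ => g k) m S k P x <=
   leaf_max stop (fun k _ => g k) m.+1 S k P x)%R.
Proof.
move=> g0 gh; elim: m S k P => [|m IH] S k P Px.
  have [e ex] := child_cover Px.
  apply: le_trans (leaf_max_ge_child stop (fun k _ => g k) 0 S k ex).
  by case: ifP => _ //=; exact: gh.
rewrite [leLHS]/=; apply: bigmax_le => [|e _]; first by apply: leaf_max_ge0 => *; exact: g0.
have [ex|nex] := pselect (cube_set (child P e) x); last first.
  by rewrite indicE memNset// mul0r; apply: leaf_max_ge0 => *; exact: g0.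
rewrite indicE mem_set// mul1r.
apply: le_trans (leaf_max_ge_child stop (fun k _ => g k) m.+1 S k ex).
by case: ifP => _; exact: IH.
Qed.

(** * The Fujii-Wilson constant and the Carleson condition *)

Section carleson_of_fujii_wilson.
Context {R : realType} {n : nat}.
Implicit Types (S P Q : cubes R n) (m k : nat) (x : 'rV[R]_n.+1).
Implicit Types (f w : 'rV[R]_n.+1 -> R).
Local Notation mu := (lebesgue_rV R n).

Lemma maximal_ge0 f x : 0 <= maximal f x.
Proof.
have Px : cube_set (x, PosNum ltr01) x.
  by apply/cube_setE => i /=; rewrite lexx lerDl/=.
apply: le_trans (ereal_sup_ubound _); last first.
  by exists (cube_set (x, PosNum ltr01)) => //; split=> //; apply/cubeP; eexists.
by rewrite mule_ge0 ?integral_ge0// inve_ge0.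
Qed.

Lemma weighted_measureE w P : weight w ->
  weighted_measure w (cube_set P) = (abs_int w P)%:E.
Proof.
move=> [wl w0]; rewrite -abs_intE; last exact: loc_integrable_cube.
apply: ae_eq_integral; first exact: measurable_cube.
- by apply/measurable_EFinP; apply: measurable_funTS; exact: wl.1.
- by apply: measurable_abs; exact: wl.1.
case: w0 => N [mN N0 subN]; exists N; split=> // x /= /not_implyP[_ wx].
by apply: subN => /= w0; apply: wx; rewrite gtr0_norm.
Qed.

Lemma weight_abs_int_gt0 w P : weight w -> (0 < abs_int w P)%R.
Proof.
move=> [wl w0]; have wc := loc_integrable_cube wl.
rewrite lt_neqAle abs_int_ge0 andbT eq_sym; apply/eqP => W0.
have mP := @measurable_cube R n P.
have : \int[mu]_(x in cube_set P) `|(w x)%:E| = 0.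
  by have := abs_intE P wc; rewrite W0.
have mw : measurable_fun (cube_set P : set (lebesgue_rV_type R n)) (fun x => (w x)%:E).
  by apply/measurable_EFinP; apply: measurable_funTS; exact: wl.1.
move=> /(ae_eq_integral_abs mu mP mw).1 [N [mN N0 subN]].
case: w0 => N' [mN' N'0 subN'].
have : mu (cube_set P) <= mu (N `|` N').
  apply: le_measure; rewrite ?inE//; first exact: measurableU.
  move=> x Px; have [wx|wx] := pselect (0 < w x)%R; last by right; exact: subN'.
  by left; apply: subN => /= /(_ Px) [] /eqP; rewrite gt_eqF.
rewrite measureU0// lebesgue_rV_cube [leRHS](_ : _ = 0)//.
by rewrite lee_fin leNgt vol_gt0.
Qed.

Lemma fujii_wilson_ge0 w : weight w -> 0 <= fujii_wilson w.
Proof.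
move=> ww; pose P : cubes R n := (0%R, PosNum ltr01).
apply: le_trans (ereal_sup_ubound _); last first.
  by exists (cube_set P) => //; apply/cubeP; exists P.
rewrite weighted_measureE// mule_ge0 ?inve_ge0 ?lee_fin ?abs_int_ge0//.
by apply: integral_ge0 => x _; exact: maximal_ge0.
Qed.

Lemma integral_maximal_le w P : Ainfty w ->
  \int[mu]_(x in cube_set P) maximal (w \_ (cube_set P)) x <=
  (fine (fujii_wilson w) * abs_int w P)%:E.
Proof.
move=> [ww wfin]; have W0 := weight_abs_int_gt0 P ww.
rewrite EFinM fineK; last by rewrite ge0_fin_numE// fujii_wilson_ge0.
rewrite -lee_pdivrMr//.
apply: ereal_sup_ubound; exists (cube_set P); first by apply/cubeP; exists P.
by rewrite weighted_measureE// inver gt_eqF// muleC.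
Qed.

Lemma leaf_max_le_bound stop g m S k P x (b : R) Q : (0 <= b)%R ->
  (forall k S, cube_set S x -> cube_set S `<=` cube_set Q -> (g k S <= b)%R) ->
  cube_set S x -> cube_set S `<=` cube_set Q -> cube_set P `<=` cube_set Q ->
  (leaf_max stop g m S k P x <= b)%R.
Proof.
move=> b0 gb; elim: m S k P => [|m IH] S k P Sx SQ PQ /=; first exact: gb.
apply: bigmax_le => // e _; rewrite indicE.
have [|_] := boolP (x \in _); last by rewrite mul0r.
have PeQ := subset_trans (@child_subset R n P e) PQ.
by rewrite mul1r inE => ex; case: ifP => _; apply: IH.
Qed.

Lemma abs_int1 P : abs_int (fun=> 1%R) P = vol P.
Proof.
rewrite /abs_int; under eq_integral do rewrite normr1.
rewrite integral_cst; last exact: measurable_cube.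
by rewrite mul1e lebesgue_rV_cube.
Qed.

(** The leaf function with the averages of w as values lies below the maximal
    function of w, so that the Fujii-Wilson constant of w controls the total
    weight of every sparse family of stopping cubes. *)
Lemma fujii_wilson_carleson stop w m S : Ainfty w ->
  (forall m S, first_stop_sum child stop vol m S S <= vol S / 2)%R ->
  (abs_int w S + stop_sum child stop (fun=> abs_int w) m S S <=
   2 * fine (fujii_wilson w) * abs_int w S)%R.
Proof.
move=> wA sparse; have wc := loc_integrable_cube wA.1.1.
have cc := @cube_integrable_cst R n 1%R.
have volD P : (\sum_e vol (child P e) = vol P)%R.
  rewrite -(abs_int1 P) -(abs_int_children P cc).
  by apply: eq_bigr => e _; rewrite abs_int1.
apply: le_trans (stop_sum_le_leaf_sum (@vol_gt0 R n) (abs_int_ge0 w) volD sparse m S 0) _.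
rewrite -mulrA ler_wpM2l// -lee_fin; apply: le_trans (integral_maximal_le S wA).
have g0 : forall (k : nat) S, (0 <= (fun _ S => abs_int w S / vol S)%R k S)%R.
  by move=> _ S'; rewrite divr_ge0 ?abs_int_ge0// ltW// vol_gt0.
have := leaf_sum_le_integral stop g0 m S 0 S cc.
rewrite (_ : abs_int (fun=> 1%R) = vol); last by apply/funext => P; exact: abs_int1.
move=> /le_trans; apply; apply: le_integral_nonneg_bound => x Sx; first exact: maximal_ge0.
rewrite normr1 mulr1.
have := maximal_ge0 (w \_ (cube_set S)) x.
case E : (maximal _ x) => [b| |]; [|by move=> _; rewrite leey|by []].
rewrite !lee_fin => b0; apply: (@leaf_max_le_bound stop _ m S 0 S x b S) => // _ P Px PS.
rewrite -lee_fin -E -averageE//; apply: ereal_sup_ubound.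
exists (cube_set P); first by split => //; apply/cubeP; exists P.
congr (_ * _); apply: eq_integral => y /set_mem Py.
by rewrite patchE mem_set//; exact: PS.
Qed.

End carleson_of_fujii_wilson.

(** * Averages and stopping cubes *)

Section pointwise.
Local Open Scope ring_scope.
Context {R : realType} {n : nat}.
Variable f : 'rV[R]_n.+1 -> R.
Hypothesis fc : cube_integrable f.
Implicit Types (S P Q D : cubes R n) (m k j : nat) (x : 'rV[R]_n.+1).

(** The oscillations are multiplied by the volumes in order to have the form that
    Chebyshev's inequality is applied to. *)
Definition dev_stop S P : bool :=
  2 * mean_dev f S S * vol P < mean_dev f S P * vol S.

Local Notation mean P := (mean f (cube_set P)).
Local Notation dev := (mean_dev f).

Let dev_integrable S : cube_integrable (fun x => f x - mean S).
Proof. exact: cube_integrable_subc. Qed.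

Lemma first_stop_sum_dev_le m S :
  first_stop_sum child dev_stop vol m S S <= vol S / 2.
Proof.
apply: (first_stop_sum_le_half (Phi := dev)) => //; first exact: vol_gt0.
- by move=> S' P; exact: abs_int_ge0.
- by move=> S' P; exact: abs_int_children.
Qed.

Lemma abs_mean_sub_dev P S : `|mean P - mean S| <= dev S P / vol P.
Proof. exact: abs_mean_sub_le. Qed.

Lemma abs_mean_le_dev P S : `|mean P| <= `|mean S| + dev S P / vol P.
Proof.
apply: le_trans (lerD (lexx _) (abs_mean_sub_dev P S)).
by rewrite -{1}(subrK (mean S) (mean P)) addrC ler_normD.
Qed.

Lemma abs_avg_le_dev P S : abs_int f P / vol P <= `|mean S| + dev S P / vol P.
Proof.
rewrite ler_pdivrMr ?vol_gt0// mulrDl divfK ?gt_eqF ?vol_gt0//.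
exact: abs_int_le.
Qed.

Lemma abs_mean_le_avg P : `|mean P| <= abs_int f P / vol P.
Proof.
have -> : abs_int f P = abs_int (fun x => f x - 0) P.
  by rewrite /abs_int; under [in RHS]eq_integral do rewrite subr0.
by rewrite -{1}(subr0 (mean P)); exact: abs_mean_sub_le.
Qed.

(* dev S P / vol P is at most the oscillation on S times the ratio of volumes. *)
Let dev_ratio P S (r M : R) : cube_set P `<=` cube_set S -> S.2%:num <= r * P.2%:num ->
  dev S S / vol S <= M -> 0 <= r -> dev S P / vol P <= r ^+ n.+1 * M.
Proof.
move=> PS rP SM r0; apply: le_trans (ler_wpM2l (exprn_ge0 _ r0) SM).
have vle : vol S <= r ^+ n.+1 * vol P.
  by rewrite /vol -exprMn lerXn2r// nnegrE// mulr_ge0.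
rewrite ler_pdivrMr ?vol_gt0// mulrAC.
apply: le_trans (abs_int_subset (dev_integrable S) PS) _.
rewrite -[leLHS](divfK (lt0r_neq0 (vol_gt0 S))) mulrC ler_wpM2r//.
by rewrite divr_ge0 ?abs_int_ge0// ltW// vol_gt0.
Qed.

Section at_point.
Variables (x : 'rV[R]_n.+1) (M : R).
Hypothesis osc_le : forall P, cube_set P x -> dev P P / vol P <= M.

Let M_ge0 : 0 <= M.
Proof.
have Px : cube_set (x, PosNum ltr01) x.
  by apply/cube_setE => i /=; rewrite lexx lerDl/=.
by apply: le_trans (osc_le Px); rewrite divr_ge0 ?abs_int_ge0// ltW// vol_gt0.
Qed.

(** Induction along the path of cubes that contain x: between two stopping cubes
    the means stay within 2 * M of the one on S, and a stopping cube adds at most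
    the factor 2 ^+ n.+1 by which it is smaller than its parent. Quantifying over
    g states that j is the number of stops counted by a leaf that contains x, in
    a form that applies to all functions of this number. *)
Lemma path_mean_le m S k P : cube_set S x -> cube_set P x ->
  dev S P * vol S <= 2 * dev S S * vol P ->
  exists D j, [/\ cube_set D x, P.2%:num = 2 ^+ m * D.2%:num, (k <= j)%N,
    `|mean D| <= `|mean S| + 2 ^+ n.+2 * M * (j - k).+1%:R &
    forall g : nat -> R, g j <= leaf_max dev_stop (fun k _ => g k) m S k P x].
Proof.
have K0 : 2 * M <= 2 ^+ n.+2 * M.
  by rewrite exprS ler_wpM2r// ler_peMr// exprn_ege1// ler1n.
have live S' P' : cube_set S' x -> dev S' P' * vol S' <= 2 * dev S' S' * vol P' ->
    dev S' P' / vol P' <= 2 * M.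
  move=> Sx h; apply: le_trans (ler_wpM2l (ler0n R 2) (osc_le Sx)).
  by rewrite ler_pdivrMr ?vol_gt0// mulrA mulrAC ler_pdivlMr ?vol_gt0.
elim: m S k P => [|m IH] S k P Sx Px liveP.
  exists P, k; split=> //; first by rewrite expr0 mul1r.
  rewrite subnn mulr1; apply: le_trans (abs_mean_le_dev P S) _.
  by rewrite lerD2l (le_trans (live S P Sx liveP)).
have [e ex] := child_cover Px; set P' := child P e in ex *.
have sideP : P.2%:num = 2 * P'.2%:num by rewrite /= mulrCA divff ?mulr1.
have [stopS|] := boolP (dev_stop S P'); last first.
  rewrite /dev_stop -leNgt => liveP'.
  have [D [j [Dx DP kj jM gj]]] := IH S k P' Sx ex liveP'.
  exists D, j; split=> //; first by rewrite sideP DP exprS mulrA.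
  move=> g; apply: le_trans (gj g) _.
  have := leaf_max_ge_child dev_stop (fun k _ => g k) m S k ex.
  by rewrite -/P' /dev_stop ltNge liveP'.
have live' : dev P' P' * vol P' <= 2 * dev P' P' * vol P'.
  by rewrite ler_wpM2r ?(ltW (vol_gt0 _))// ler_peMl ?abs_int_ge0// ler1n.
have [D [j [Dx DP kj jM gj]]] := IH P' k.+1 P' ex ex live'.
exists D, j; split=> //; first by rewrite sideP DP exprS mulrA.
- exact: ltnW.
- have -> : (j - k).+1%:R = 1 + (j - k.+1).+1%:R :> R.
    by rewrite -(subnSK kj) -[LHS]natr1 addrC.
  apply: le_trans jM _; rewrite mulrDr mulr1 addrA lerD2r.
  apply: le_trans (abs_mean_le_dev P' S) _; rewrite lerD2l.
  (* The parent P of the stopping cube P' is S or not a stopping cube itself. *)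
  have -> : dev S P' / vol P' = 2 ^+ n.+1 * (dev S P' / vol P).
    by rewrite (vol_child P e) -/P'; field; rewrite gt_eqF ?vol_gt0// expf_neq0.
  rewrite [in leRHS]exprSr -[leRHS]mulrA ler_wpM2l ?exprn_ge0//.
  apply: le_trans (live S P Sx liveP).
  rewrite ler_wpM2r ?invr_ge0 ?(ltW (vol_gt0 _))//.
  by apply: abs_int_subset => //; exact: child_subset.
- move=> g; apply: le_trans (gj g) _.
  have := leaf_max_ge_child dev_stop (fun k _ => g k) m S k ex.
  by rewrite -/P' stopS.
Qed.

Lemma avg_le_hull P S : cube_set P `<=` cube_set S -> cube_set S x ->
  S.2%:num <= 4 * P.2%:num ->
  abs_int f P / vol P <= `|mean S| + 4 ^+ n.+1 * M.
Proof.
move=> PS Sx SP; apply: le_trans (abs_avg_le_dev P S) _.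
by rewrite lerD2l dev_ratio// osc_le.
Qed.

(** A cube P that is smaller than Q is compared with the cube D that contains x in
    the generation m of the tree whose sides are between one and two times that
    of P, through a common cube S; a cube P that is larger than Q is compared
    directly with a cube S that contains Q. *)
Lemma average_le_leaf_max Q (lambda : R) P : cube_set Q x -> cube_set P x ->
  (forall S, cube_set Q `<=` cube_set S -> abs_int f S / vol S <= lambda) ->
  exists m j, [/\ (0 < j)%N,
    abs_int f P / vol P <= lambda + (2 ^+ n.+2 + 2 * 4 ^+ n.+1) * M * j%:R &
    forall g : nat -> R, g j <= leaf_max dev_stop (fun k _ => g k) m Q 1 Q x].
Proof.
have chain (s d q l c k : R) :
    s <= d + c -> d <= q + k -> q <= l -> s + c <= l + (k + (c + c)) by lra.
have side4 (r t : R) : 0 <= t -> r = 2 * t -> r <= 4 * t by lra.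
move=> Qx Px lam; have c4 : 0 <= 4 ^+ n.+1 * M by rewrite mulr_ge0 ?exprn_ge0.
have [QP|PQ] := leP Q.2%:num P.2%:num.
  have [S [QS PS sideS]] := cube_hull Qx Px QP.
  exists 0, 1%N; split=> //; rewrite mulr1.
  apply: le_trans (avg_le_hull PS (PS x Px) (side4 _ _ _ sideS)) _ => //.
  apply: lerD; first exact: le_trans (abs_mean_le_avg S) (lam S QS).
  rewrite ler_wpM2r//; apply: (@le_trans _ _ (2 * 4 ^+ n.+1)).
    by rewrite ler_peMl ?exprn_ge0// ler1n.
  by rewrite lerDr exprn_ge0.
have [m /andP[mP Pm]] : exists m, (2 ^+ m * P.2%:num <= Q.2%:num < 2 ^+ m.+1 * P.2%:num).
  have ex_m : exists m, Q.2%:num < 2 ^+ m * P.2%:num.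
    have QP0 : 0 <= Q.2%:num / P.2%:num by [].
    exists (Num.bound (Q.2%:num / P.2%:num)); rewrite -ltr_pdivrMr//.
    apply: lt_le_trans (archi_boundP QP0) _.
    by rewrite -natrX ler_nat ltnW// ltn_expl.
  case: (ex_minnP ex_m) => -[|m] mP m_min.
    by move: mP; rewrite mul1r ltNge (ltW PQ).
  exists m; rewrite mP andbT leNgt; apply/negP => /m_min.
  by rewrite ltnn.
have live : dev Q Q * vol Q <= 2 * dev Q Q * vol Q.
  by rewrite ler_wpM2r ?(ltW (vol_gt0 _))// ler_peMl ?abs_int_ge0// ler1n.
have [D [j [Dx sideD j1 meanD gj]]] := path_mean_le m 1 Qx Qx live.
exists m, j; split=> //.
have [m0 m1] : 0 < 2 ^+ m :> R /\ 2 ^+ m.+1 = 2 * 2 ^+ m :> R by rewrite exprS exprn_gt0.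
have PD : P.2%:num <= D.2%:num by move: mP; rewrite sideD ler_pM2l.
have DP : D.2%:num <= 2 * P.2%:num.
  by move: Pm; rewrite sideD exprSr -mulrA ltr_pM2l// => /ltW.
have [S [PS DS sideS]] := cube_hull Px Dx PD.
have Sx := PS x Px.
have SP : S.2%:num <= 4 * P.2%:num.
  by rewrite sideS [4](natrM _ 2 2) -mulrA ler_wpM2l.
apply: le_trans (avg_le_hull PS Sx SP) _.
have meanS : `|mean S| <= `|mean D| + 4 ^+ n.+1 * M.
  apply: le_trans (_ : `|mean D| + dev S D / vol D <= _).
    apply: le_trans (lerD (lexx _) (abs_mean_sub_dev D S)); rewrite distrC.
    by rewrite -{1}(subrK (mean D) (mean S)) addrC ler_normD.
  rewrite lerD2l; apply: dev_ratio => //; last exact: osc_le.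
  exact: side4.
have meanQ := le_trans (abs_mean_le_avg Q) (lam Q (@subset_refl _ _)).
move: meanD; rewrite subn1 prednK// => meanD.
apply: le_trans (chain _ _ _ _ _ _ meanS meanD meanQ) _.
rewrite lerD2l mulrDl mulrDl lerD2l -mulr2n -[leLHS]mulr_natl mulrA.
by rewrite ler_peMr ?ler1n// -mulrA mulr_ge0.
Qed.

End at_point.
End pointwise.

(** * The weighted estimates *)

Lemma powR_le_1Dexp (R : realType) (t p : R) (q : nat) :
  (0 <= t)%R -> (0 <= p <= q%:R)%R -> (t `^ p <= 1 + t ^+ q)%R.
Proof.
move=> t0 /andP[p0 pq]; have [t1|t1] := leP t 1%R.
  apply: (@le_trans _ _ 1%R); last by rewrite lerDl exprn_ge0.
  have := @ge0_ler_powR R p p0 t 1%R; rewrite powR1; apply=> //; by rewrite nnegrE.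
apply: (@le_trans _ _ (t `^ q%:R)%R); first by apply: ler_powR => //; exact: ltW.
by rewrite powR_mulrn// lerDr.
Qed.

Lemma fact_le_expn q : (q`! <= q ^ q)%N.
Proof.
elim: q => // q IH; rewrite factS expnS leq_mul2l/=.
by case: q IH => // q IH; apply: leq_trans IH _; rewrite leq_exp2r.
Qed.

Section weighted_estimates.
Context {R : realType} {n : nat}.
Variables (f w : 'rV[R]_n.+1 -> R) (Q : cubes R n).
Hypothesis fl : loc_integrable f.
Hypothesis wA : Ainfty w.
Local Notation mu := (lebesgue_rV R n).
Local Notation H q m := (leaf_max (dev_stop f) (fun k _ => k%:R ^+ q)%R m Q 1 Q).
Local Notation A := (2 * fine (fujii_wilson w))%R.

Let fc : cube_integrable f := loc_integrable_cube fl.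
Let wc : cube_integrable w := loc_integrable_cube wA.1.1.
Let W_gt0 P : (0 < abs_int w P)%R := weight_abs_int_gt0 P wA.1.

(** The Carleson condition for the single cube Q. *)
Lemma double_fujii_wilson_ge1 : (1 <= A)%R.
Proof.
have := fujii_wilson_carleson 0 Q wA (first_stop_sum_dev_le fc).
by rewrite /= addr0 ler_pMl.
Qed.

(** With q the least integer above p, powR_le_1Dexp is applied to k / a for the
    bound a = A * q of the norm of the number of stops; since q <= 2 * p, the
    result stays linear in p. *)
Lemma leaf_sum_powR_le (p K : R) m : (1 <= p)%R -> (0 <= K)%R ->
  (leaf_sum child (dev_stop f) (fun k _ => (K * k%:R) `^ p) (abs_int w) m Q 1 Q <=
   2 * (2 * K * A * p) `^ p * abs_int w Q)%R.
Proof.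
move=> p1 K0; have A1 := double_fujii_wilson_ge1.
have A0 : (0 < A)%R by rewrite (lt_le_trans _ A1).
have p0 : (0 < p)%R by rewrite (lt_le_trans _ p1).
pose q := (Num.truncn p).+1.
have /andP[q_le p_lt] := truncn_itv (ltW p0).
have qp : (q%:R <= 2 * p)%R by rewrite /q -natr1; lra.
pose a := (A * q%:R)%R; have a0 : (0 < a)%R by rewrite mulr_gt0// ltr0n.
have aq0 : (0 < a ^+ q)%R by rewrite exprn_gt0.
have Ka0 : (0 <= K * a)%R by rewrite mulr_ge0// ltW.
have le_pow k (S : cubes R n) :
    ((K * k%:R) `^ p <= (K * a) `^ p + (K * a) `^ p / a ^+ q * k%:R ^+ q)%R.
  have -> : (K * k%:R = K * a * (k%:R / a))%R by rewrite mulrACA divff ?mulr1// gt_eqF.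
  have ka0 : (0 <= k%:R / a)%R by rewrite divr_ge0// ltW.
  rewrite powRM// -mulrA -[X in (_ <= X + _)%R]mulr1 -mulrDr ler_wpM2l ?powR_ge0//.
  apply: le_trans (powR_le_1Dexp (q := q) ka0 _) _; first by rewrite (ltW p0) ltW.
  by rewrite expr_div_n [X in (_ + X <= _)%R]mulrC.
have WD P := abs_int_children P wc.
apply: le_trans (@leaf_sum_affine_le _ _ _ child (dev_stop f)
  (fun k _ => (K * k%:R) `^ p)%R (fun k _ => k%:R ^+ q)%R _ _ _ m Q 1 Q
  (abs_int_ge0 w) WD le_pow) _.
have carleson m' S := fujii_wilson_carleson m' S wA (first_stop_sum_dev_le fc).
have moment : (leaf_sum child (dev_stop f) (fun k _ => k%:R ^+ q) (abs_int w) m Q 1 Q <=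
    a ^+ q * abs_int w Q)%R.
  apply: le_trans (leaf_sum_moment_le (abs_int_ge0 w) WD (ltW A0) carleson q m Q) _.
  rewrite ler_wpM2r ?abs_int_ge0// /a [in leRHS]exprMn mulrC.
  by rewrite ler_wpM2l ?exprn_ge0 ?(ltW A0)// -natrX ler_nat fact_le_expn.
apply: (@le_trans _ _ ((K * a) `^ p * abs_int w Q + (K * a) `^ p * abs_int w Q)%R).
  rewrite lerD2l; apply: le_trans (ler_wpM2l _ moment) _.
    by rewrite divr_ge0 ?powR_ge0// ltW.
  by rewrite mulrA divfK// gt_eqF.
rewrite -mulrDl -mulr2n -[X in (X * _ <= _)%R]mulr_natl ler_wpM2r ?abs_int_ge0//.
rewrite ler_wpM2l//; apply: ge0_ler_powR; rewrite ?nnegrE ?(ltW p0)//.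
  by apply: mulr_ge0 (ltW p0); apply: mulr_ge0 (ltW A0); rewrite mulr_ge0.
rewrite /a mulrA [leRHS](_ : _ = K * A * (2 * p))%R; last by ring.
by rewrite ler_wpM2l// mulr_ge0// ltW.
Qed.

(** K times the supremum over all depths m of the number j of stopping cubes, Q
    included, on a path to x; such a j is described by its effect on the leaf
    functions, as in path_mean_le. *)
Definition path_sup (K : R) x : \bar R := ereal_sup
  [set y | exists m j, [/\ (0 < j)%N, y = (K * j%:R)%:E &
    forall g : nat -> R, (g j <= leaf_max (dev_stop f) (fun k _ => g k) m Q 1 Q x)%R]].

Lemma path_sup_ge K x : K%:E <= path_sup K x.
Proof.
by apply: ereal_sup_ubound; exists 0%N, 1%N; split=> //; rewrite mulr1.
Qed.

Lemma maximal_le_path_sup (lambda M : R) x : cube_set Q x -> (0 <= M)%R ->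
  (forall P, cube_set P x -> mean_dev f P P / vol P <= M)%R ->
  (forall S, cube_set Q `<=` cube_set S -> abs_int f S / vol S <= lambda)%R ->
  maximal f x <= lambda%:E + path_sup ((2 ^+ n.+2 + 2 * 4 ^+ n.+1) * M) x.
Proof.
move=> Qx M0 osc lam; apply: ge_ereal_sup => _ [P' [/cubeP[P ->] Px] <-].
rewrite (averageE P fc).
have [m [j [j0 jP gj]]] := average_le_leaf_max fc osc Qx Px lam.
apply: le_trans (_ : (_ + _ * j%:R)%:E <= _); first by rewrite lee_fin; exact: jP.
by rewrite EFinD leeD2l//; apply: ereal_sup_ubound; exists m, j.
Qed.

Section limit.
Variables (p K : R).
Hypotheses (p1 : (1 <= p)%R) (K0 : (0 <= K)%R).

Let p0 : (0 < p)%R. Proof. by rewrite (lt_le_trans _ p1). Qed.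

Let g (k : nat) : R := ((K * k%:R) `^ p)%R.

Let g_ge0 k : (0 <= g k)%R. Proof. exact: powR_ge0. Qed.

Let G m x : R := (leaf_max (dev_stop f) (fun k _ => g k) m Q 1 Q x * `|w x|)%R.

Let G_ge0 m x : (0 <= G m x)%R.
Proof. by rewrite mulr_ge0//; apply: leaf_max_ge0 => k _; exact: g_ge0. Qed.

Let measurable_G m :
  measurable_fun (cube_set Q : set (lebesgue_rV_type R n)) (fun x => (G m x)%:E).
Proof.
by apply: measurable_leaf_density wc => k _; exact: g_ge0.
Qed.

Let nondecreasing_G x : cube_set Q x -> nondecreasing_seq (fun m => (G m x)%:E).
Proof.
move=> Qx; apply/nondecreasing_seqP => m; rewrite lee_fin ler_wpM2r//.
apply: leaf_max_nondecreasing => [|i j ij|//]; first exact: g_ge0.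
apply: ge0_ler_powR; rewrite ?nnegrE ?mulr_ge0 ?(ltW p0)//.
by rewrite ler_wpM2l// ler_nat.
Qed.

Let L x : \bar R := limn (fun m => (G m x)%:E).

Let G_le_L m x : cube_set Q x -> (G m x)%:E <= L x.
Proof.
move=> Qx; rewrite /L (cvg_lim _ (ereal_nondecreasing_cvgn (nondecreasing_G Qx)))//.
by apply: ereal_sup_ubound; exists m.
Qed.

Let L_ge0 x : cube_set Q x -> 0 <= L x.
Proof. by move=> Qx; apply: le_trans (G_le_L 0%N Qx); rewrite lee_fin G_ge0. Qed.

Let measurable_L : measurable_fun (cube_set Q : set (lebesgue_rV_type R n)) L.
Proof.
apply: (@emeasurable_fun_cvg _ (lebesgue_rV_type R n) R (cube_set Q)
  (fun m x => (G m x)%:E) L measurable_G) => x Qx.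
exact: ereal_nondecreasing_is_cvgn (nondecreasing_G Qx).
Qed.

Let bound := (2 * (2 * K * A * p) `^ p * abs_int w Q)%R.

Let integral_L_le : \int[mu]_(x in cube_set Q) L x <= bound%:E.
Proof.
have g0 (k : nat) (S : cubes R n) : (0 <= (fun k _ => g k)%R k S)%R by exact: g_ge0.
rewrite (monotone_convergence mu (measurable_cube Q) measurable_G); last 2 first.
- by move=> m x _; rewrite lee_fin G_ge0.
- by move=> x Qx; exact: nondecreasing_G.
apply: lime_le; last first.
  apply: nearW => m; apply: le_trans (integral_le_leaf_sum _ g0 _ _ _ _ wc) _.
  by rewrite lee_fin; exact: leaf_sum_powR_le.
apply: ereal_nondecreasing_is_cvgn => i j ij.
apply: le_integral_nonneg_bound => x Qx; first by rewrite lee_fin G_ge0.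
exact: nondecreasing_G.
Qed.

(** The supremum is taken out of the p-th power by passing to p-th roots: every
    K * j is at most the p-th root of L x / w x. *)
Let path_sup_powR_le x (v : \bar R) : cube_set Q x -> (0 < w x)%R ->
  0 <= v -> v <= path_sup K x -> v `^ p * (w x)%:E <= L x.
Proof.
move=> Qx w0 v0 vx.
have := L_ge0 Qx; case E : (L x) => [l| |] // l0; last by rewrite leey.
rewrite lee_fin in l0; have lw0 : (0 <= l / w x)%R by rewrite divr_ge0 ?(ltW w0).
have v_le : v <= ((l / w x) `^ p^-1)%:E.
  apply: le_trans vx _; apply: ge_ereal_sup => _ [m [j [j0 -> gj]]].
  rewrite lee_fin; have Kj0 : (0 <= K * j%:R)%R by rewrite mulr_ge0.
  rewrite (_ : (K * j%:R)%R = (((K * j%:R) `^ p) `^ p^-1)%R); last first.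
    by rewrite -powRrM mulfV ?powRr1// gt_eqF.
  apply: ge0_ler_powR; rewrite ?nnegrE ?invr_ge0 ?powR_ge0 ?(ltW p0)//.
  rewrite ler_pdivlMr// -lee_fin -E; apply: le_trans (G_le_L m Qx).
  rewrite lee_fin /G (gtr0_norm w0); apply: ler_wpM2r; first exact: ltW.
  exact: (gj g).
case: v v0 v_le {vx} => [r| |]; [|by move=> _; rewrite leye_eq|by []].
rewrite !lee_fin => r0 rl; rewrite -ler_pdivlMr//.
apply: le_trans (ge0_ler_powR (ltW p0) _ _ rl) _; rewrite ?nnegrE ?powR_ge0//.
by rewrite -powRrM mulVf ?gt_eqF// powRr1.
Qed.

(** Nothing is known about the measurability of v and about its values on Z; a
    measurable bound of the integrand is obtained by adding infinity on Z. In the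
    constant 8, one factor 2 comes from the p-th root of leaf_sum_powR_le, one
    from q <= 2 * p and one from the sparseness of the stopping cubes. *)
Lemma weighted_Lp_mean_le (v : 'rV[R]_n.+1 -> \bar R)
    (Z : set (lebesgue_rV_type R n)) :
  measurable Z -> mu Z = 0 -> (forall x, ~ Z x -> (0 < w x)%R) ->
  (forall x, cube_set Q x -> ~ Z x -> v x = -oo \/ 0 <= v x <= path_sup K x) ->
  weighted_Lp_mean w p (cube_set Q) v <= (8 * K * p)%:E * fujii_wilson w.
Proof.
move=> mZ Z0 wZ vZ; have mQ := @measurable_cube R n Q.
have null := integral_pinfty_null mQ mZ Z0.
have I_ge0 x : 0 <= +oo * (\1_Z x)%:E :> \bar R by rewrite mule_ge0// lee_fin.
pose h x := v x `^ p * (w x)%:E.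
have h_le x : cube_set Q x -> h x <= L x + +oo * (\1_Z x)%:E.
  move=> Qx; have [Zx|nZx] := pselect (Z x).
    rewrite indicE mem_set// mule1 addey ?leey//.
    by rewrite gt_eqF// (lt_le_trans ltNy0)// L_ge0.
  apply: (@le_trans _ _ (L x)); last by rewrite leeDl.
  have [vNy|/andP[v0 vx]] := vZ x Qx nZx.
    by rewrite /h vNy poweRNyr ?gt_eqF// mul0e L_ge0.
  exact: path_sup_powR_le (wZ x nZx) v0 vx.
have int_le : \int[mu]_(x in cube_set Q) h x <= bound%:E.
  apply: le_trans integral_L_le; rewrite -[leRHS]adde0 -[X in _ + X]null.
  rewrite -ge0_integralD; [|exact: mQ|exact: L_ge0|exact: measurable_L|by []|].
    by apply: le_integral_nonneg_bound => x Qx; [rewrite adde_ge0 ?L_ge0|exact: h_le].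
  by apply: emeasurable_funM; [exact: measurable_cst|
    apply/measurable_EFinP; exact: measurable_indic].
(* Powers of negative real numbers are 1, so the integral has to be nonnegative
   before roots are taken. *)
have int_ge0 : 0 <= \int[mu]_(x in cube_set Q) h x.
  rewrite integralE (_ : \int[mu]_(x in cube_set Q) h^\- x = 0); last first.
    apply/eqP; rewrite eq_le integral_ge0 ?andbT// -null.
    apply: le_integral_nonneg_bound => x Qx //.
    have [Zx|nZx] := pselect (Z x); first by rewrite indicE mem_set// mule1 leey.
    rewrite funenegE ge_max I_ge0 andbT; apply: le_trans (I_ge0 x).
    by rewrite leeNl oppe0 mule_ge0 ?poweR_ge0// lee_fin ltW// wZ.
  by rewrite sube0 integral_ge0.
have W0 := W_gt0 Q.
have KAp0 : (0 <= 2 * K * A * p)%R.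
  by rewrite !mulr_ge0 ?(ltW p0)// fine_ge0// fujii_wilson_ge0//; exact: wA.1.
rewrite /weighted_Lp_mean (weighted_measureE Q wA.1) inver gt_eqF//.
apply: (@le_trans _ _ ((2 * (2 * K * A * p) `^ p)%:E `^ p^-1)).
  apply: gt0_ler_poweR; rewrite ?invr_ge0 ?(ltW p0)//.
  - by rewrite in_itv/= leey andbT mule_ge0// lee_fin invr_ge0 ltW.
  - by rewrite in_itv/= leey andbT lee_fin mulr_ge0 ?powR_ge0.
  apply: le_trans (lee_wpmul2l _ int_le) _; first by rewrite lee_fin invr_ge0 ltW.
  by rewrite -EFinM mulrC mulfK ?gt_eqF.
rewrite -[X in _ <= _ * X](@fineK _ (fujii_wilson w)); last first.
  by rewrite ge0_fin_numE ?wA.2// fujii_wilson_ge0//; exact: wA.1.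
rewrite poweR_EFin -EFinM lee_fin powRM ?powR_ge0// -powRrM mulfV ?gt_eqF// powRr1//.
apply: (@le_trans _ _ (2 * (2 * K * A * p))%R).
  by rewrite ler_wpM2r// ler1_powR ?invf_le1// ler1n.
by rewrite le_eqVlt; apply/orP; left; apply/eqP; ring.
Qed.

End limit.
End weighted_estimates.

Lemma dim_const_gt0 (R : realType) (n : nat) :
  (0 < 2 ^+ n.+2 + 2 * 4 ^+ n.+1 :> R)%R.
Proof. by apply: addr_gt0; [|apply: mulr_gt0 => //]; exact: exprn_gt0. Qed.

Section main.
Context {R : realType} {n : nat}.
Variables (f w : 'rV[R]_n.+1 -> R) (Q : cubes R n) (p : R).
Hypothesis fl : loc_integrable f.
Hypothesis wA : Ainfty w.
Hypothesis p1 : (1 <= p)%R.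
Local Notation mu := (lebesgue_rV R n).
Local Notation lam := (ess_inf_on (cube_set Q) (maximal f)).
Local Notation K0 := (2 ^+ n.+2 + 2 * 4 ^+ n.+1)%R.

(** The average over S is a lower bound of the maximal function on all of Q. *)
Lemma average_le_ess_inf S : cube_set Q `<=` cube_set S ->
  (abs_int f S / vol S)%:E <= lam.
Proof.
move=> QS; apply: ereal_sup_ubound; apply: nearW => x /=.
rewrite /patch; case: ifPn => [/set_mem Qx|_]; last by rewrite leey.
rewrite -averageE; last exact: loc_integrable_cube.
apply: ereal_sup_ubound; exists (cube_set S) => //; split; last exact: QS.
by apply/cubeP; exists S.
Qed.

Lemma null_set_weight_ess_inf : exists Z : set (lebesgue_rV_type R n),
  [/\ measurable Z, mu Z = 0, forall x, ~ Z x -> (0 < w x)%R &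
   forall x, cube_set Q x -> ~ Z x -> lam <= maximal f x].
Proof.
have [N [mN N0 subN]] := ess_inf_le mu (patch (fun=> +oo) (cube_set Q) (maximal f)).
have [N' [mN' N'0 subN']] := wA.1.2.
exists (N `|` N'); split; [exact: measurableU|by rewrite measureU0|..].
- by move=> x nZ; apply: contrapT => h; apply: nZ; right; exact: subN'.
- move=> x Qx nZ; apply: contrapT => h; apply: nZ; left; apply: subN => /=.
  by rewrite /patch mem_set.
Qed.

Let fc : cube_integrable f := loc_integrable_cube fl.

Lemma mean_dev_ge0 P : (0 <= mean_dev f P P / vol P)%R.
Proof. by rewrite divr_ge0 ?abs_int_ge0// ltW// vol_gt0. Qed.

Lemma mean_dev_le_sharp P x : cube_set P x ->
  (mean_dev f P P / vol P)%:E <= sharp_maximal f x.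
Proof.
move=> Px; rewrite -(oscillationE P fc); apply: ereal_sup_ubound.
by exists (cube_set P) => //; split=> //; apply/cubeP; exists P.
Qed.

Lemma mean_dev_le_bmo P : (mean_dev f P P / vol P)%:E <= bmo_norm f.
Proof.
rewrite -(oscillationE P fc); apply: ereal_sup_ubound.
by exists (cube_set P) => //; apply/cubeP; exists P.
Qed.

Lemma maximal_sub_le (l M : R) x : cube_set Q x -> (0 <= M)%R ->
  (forall P, cube_set P x -> mean_dev f P P / vol P <= M)%R -> lam = l%:E ->
  maximal f x - l%:E <= path_sup f Q (K0 * M) x.
Proof.
move=> Qx M0 osc laml; rewrite leeBlDl//; apply: maximal_le_path_sup => // S QS.
by rewrite -lee_fin -laml; exact: average_le_ess_inf.
Qed.

Lemma ess_inf_neqNy : lam != -oo.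
Proof.
by rewrite -ltNye (lt_le_trans _ (average_le_ess_inf (@subset_refl _ _)))// ltNyr.
Qed.

Lemma weighted_sharp_maximal_le :
  weighted_Lp_mean w p (cube_set Q) (fun x => (maximal f x - lam) / sharp_maximal f x)
  <= (8 * K0 * p)%:E * fujii_wilson w.
Proof.
have [Z [mZ Z0 wZ lZ]] := null_set_weight_ess_inf.
have K0_ge0 : (0 <= K0 :> R)%R by apply: ltW; exact: dim_const_gt0.
apply: (weighted_Lp_mean_le fl wA p1 K0_ge0 mZ Z0) => // x Qx nZx.
have s_ge0 : 0 <= sharp_maximal f x.
  by apply: le_trans (mean_dev_le_sharp Qx); rewrite lee_fin mean_dev_ge0.
have K_sup : 0 <= path_sup f Q K0 x by apply: le_trans (path_sup_ge _ _ _ _).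
move: (lZ x Qx nZx); case E : lam ess_inf_neqNy => [l| |] // _ l_le; last first.
  (* If the essential infimum is infinite, the difference is -oo by convention. *)
  have : 0 <= (sharp_maximal f x)^-1 by rewrite inve_ge0.
  rewrite addeNy le_eqVlt => /orP[/eqP<-|s_gt0]; last by left; rewrite gt0_mulNye.
  by right; rewrite mule0 lexx.
right; have sub_ge0 : 0 <= maximal f x - l%:E by rewrite sube_ge0.
rewrite mule_ge0 ?inve_ge0//=.
move: s_ge0; case Es : (sharp_maximal f x) => [s| |] //; last by rewrite invey mule0.
rewrite lee_fin => s_ge0.
have osc P : cube_set P x -> (mean_dev f P P / vol P <= s)%R.
  by move=> Px; rewrite -lee_fin -Es; exact: mean_dev_le_sharp.
have le_s := maximal_sub_le Qx s_ge0 osc E.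
(* When s = 0, the bound forces the difference to vanish, and 0 * +oo = 0. *)
have [s0|s_neq0] := eqVneq s 0%R.
  suff -> : maximal f x - l%:E = 0 by rewrite mul0e.
  apply/eqP; rewrite eq_le sub_ge0 andbT; apply: le_trans le_s _.
  apply: ge_ereal_sup => _ [m [j [_ -> _]]].
  by rewrite s0 mulr0 mul0r.
have s_gt0 : (0 < s)%R by rewrite lt_neqAle eq_sym s_neq0.
rewrite inver (negPf s_neq0) lee_pdivrMr//; apply: le_trans le_s _.
apply: ge_ereal_sup => _ [m [j [j0 -> gj]]].
rewrite mulrAC EFinM lee_wpmul2r//; apply: ereal_sup_ubound.
by exists m, j.
Qed.

Lemma weighted_bmo_le : bmo_norm f < +oo ->
  weighted_Lp_mean w p (cube_set Q) (fun x => maximal f x - lam)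
  <= (8 * K0 * p)%:E * fujii_wilson w * bmo_norm f.
Proof.
move=> bfin; have [Z [mZ Z0 wZ lZ]] := null_set_weight_ess_inf.
have b_ge0 : 0 <= bmo_norm f.
  by apply: le_trans (mean_dev_le_bmo Q); rewrite lee_fin mean_dev_ge0.
move: b_ge0 bfin (mean_dev_le_bmo); case: (bmo_norm f) => [b| |] // b_ge0 _ osc.
have K_ge0 : (0 <= K0 * b)%R by rewrite mulr_ge0// ltW// dim_const_gt0.
rewrite muleAC -EFinM (_ : 8 * K0 * p * b = 8 * (K0 * b) * p)%R; last by ring.
apply: (weighted_Lp_mean_le fl wA p1 K_ge0 mZ Z0) => // x Qx nZx.
move: (lZ x Qx nZx); case E : lam ess_inf_neqNy => [l| |] // _ l_le; last first.
  by left; rewrite addeNy.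
right; rewrite sube_ge0// l_le/=; apply: maximal_sub_le => // P _.
by rewrite -lee_fin; exact: osc.
Qed.

End main.

Theorem theorem1p1 (R : realType) (n : nat) :
  exists c : R, (0 < c)%R /\
    forall f w : 'rV[R]_n.+1 -> R,
      loc_integrable f -> ~ ae_constant f ->
      (exists x, maximal f x <> +oo) ->
      Ainfty w ->
      (forall (Q : set 'rV[R]_n.+1) (p : R), cube Q -> (1 <= p)%R ->
         weighted_Lp_mean w p Q
           (fun x => (maximal f x - ess_inf_on Q (maximal f))
                     / sharp_maximal f x)
         <= c%:E * fujii_wilson w * p%:E) /\
      (bmo f -> forall (p : R), (1 <= p)%R ->
         forall Q : set 'rV[R]_n.+1, cube Q ->
         weighted_Lp_mean w p Q
           (fun x => maximal f x - ess_inf_on Q (maximal f))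
         <= c%:E * fujii_wilson w * p%:E * bmo_norm f).
Proof.
exists (8 * (2 ^+ n.+2 + 2 * 4 ^+ n.+1))%R; split.
  by rewrite mulr_gt0// dim_const_gt0.
move=> f w fl _ _ wA; split=> [_ p /cubeP[Q ->] p1|[_ bf] p p1 _ /cubeP[Q ->]].
  by rewrite muleAC -EFinM; exact: weighted_sharp_maximal_le.
by rewrite (muleAC _ (fujii_wilson w) p%:E) -EFinM; exact: weighted_bmo_le.
Qed.
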